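(* Let $(k_n)_{n\ge 1}$ be positive integers with $k_n\to\infty$ as $n\to\infty$, and let $\{\xi_{n,j} : 1\le j\le k_n,\ n\ge 1\}$ be a triangular array of real random variables on a probability space $(X,\mathscr{B},P)$ such that, for each $n\ge 1$, the random variables $\xi_{n,1},\dots,\xi_{n,k_n}$ are independent, and $E\xi_{n,j}=0$, $E\xi_{n,j}^2<\infty$ for all $1\le j\le k_n$, $n\ge 1$. Put $S_n=\sum_{j=1}^{k_n}\xi_{n,j}$ and let $DS_n$ denote the variance of $S_n$, with $DS_n>0$ for all $n\ge 1$. Suppose that (i) for every $\varepsilon>0$, $$P\Big(\max_{1\le j\le k_n}\frac{|\xi_{n,j}|}{\sqrt{DS_n}}\ge\varepsilon\Big)\to 0\quad\text{as } n\to\infty;$$ (ii) the family $\{S_n^2/DS_n : n\ge 1\}$ is uniformly integrable. Then the central limit theorem holds for $\{\xi_{n,j}\}$, that is, for every $x\in\mathbb{R}$, $$\lim_{n\to\infty}P\Big(\frac{S_n}{\sqrt{DS_n}}\le x\Big)=\frac{1}{\sqrt{2\pi}}\int_{-\infty}^{x}e^{-t^2/2}\,dt .$$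
   Context: A family of random variables $\{\eta_n : n\ge 1\}$ is uniformly integrable if $\sup_{n}\int_{\{|\eta_n|>C\}}|\eta_n|\,dP\to 0$ as $C\to\infty$. Independence is required only within each row $n$ of the array; no independence between different rows is assumed. *)

(* Defs.v *)
From mathcomp Require Import all_boot all_order all_algebra.
From mathcomp Require Import all_classical all_reals all_analysis.

Set Implicit Arguments.
Unset Strict Implicit.
Unset Printing Implicit Defensive.

Import Order.TTheory GRing.Theory Num.Theory.
Import numFieldNormedType.Exports.

Local Open Scope classical_set_scope.
Local Open Scope ring_scope.
Local Open Scope ereal_scope.

Definition mutually_independent (R : realType) (d : measure_display)
    (T : measurableType d) (P : probability T R) (I : finType)
    (X : I -> {RV P >-> R}) : Prop :=
  forall (J : {set I}) (B : I -> set R),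
    (forall i, i \in J -> measurable (B i)) ->
    P (\bigcap_(i in [set` J]) (X i @^-1` B i)) =
    \prod_(i in J) P (X i @^-1` B i).

Definition uniformly_integrable (R : realType) (d : measure_display)
    (T : measurableType d) (P : probability T R) (I : Type) (D : set I)
    (eta : I -> T -> R) : Prop :=
  ereal_sup [set \int[P]_(t in [set t | (C < `|eta i t|)%R]) (`|eta i t|%R)%:E
            | i in D] @[C --> +oo%R] --> 0.

Definition row_sum (R : realType) (d : measure_display) (T : measurableType d)
    (P : probability T R) (k : nat -> nat)
    (xi : forall n, 'I_(k n) -> {RV P >-> R}) (n : nat) : T -> R :=
  fun t => (\sum_(j < k n) xi n j t)%R.

(* [fine] sends an infinite variance to 0; a row of square-integrable
   variables has a finite one. *)
Definition row_var (R : realType) (d : measure_display) (T : measurableType d)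
    (P : probability T R) (k : nat -> nat)
    (xi : forall n, 'I_(k n) -> {RV P >-> R}) (n : nat) : R :=
  fine 'V_P[row_sum xi n].

(* Main.v *)
From HB Require Import structures.
Require Import Defs.
From mathcomp Require Import all_boot all_order all_algebra.
From mathcomp Require Import all_classical all_reals all_analysis.
From mathcomp Require Import measurable_realfun.
From mathcomp Require Import ring lra.

(** Divide each row by its standard deviation, so that the row consists of
    independent centred variables [X_i] whose sum [W] has variance 1. The proof
    turns the hypotheses into Lindeberg's condition and then replaces the
    summands, one at a time, by Gaussian ones.

    Lindeberg's condition. Fix [e > 0]. Let [A_i] be the event [e < |X_i|], let
    [C_i] be the event that no other entry of the row exceeds [e], and put
    [V_i = W - X_i]. As [X_i] is independent of the pair [V_i, C_i], expanding
    the square of [W = V_i + X_i] gives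
      E[W^2; A_i, C_i] = E[X_i^2; A_i] P(C_i) + 2 E[X_i; A_i] E[V_i; C_i]
                         + P(A_i) E[V_i^2; C_i].
    The last term is nonnegative. The middle one is small compared with
    [E[X_i^2; A_i]] once exceedances are rare: [|E[X_i; A_i]|] is at most
    [E[X_i^2; A_i] / e], and [E[V_i; C_i]] is minus the mean of [V_i] over the
    rare complement of [C_i]. Hence [E[X_i^2; A_i] <= 2 E[W^2; A_i, C_i]]; the
    events [A_i, C_i] being disjoint, the sum of the [E[X_i^2; A_i]] is at most
    twice the mean of [W^2] over the event that some entry exceeds [e]
    ([lindeberg_of_rare_excess]). That event has vanishing probability by (i),
    so this mean vanishes by the uniform integrability (ii)
    ([square_tails_le]).

    Replacement. Let [gauss_op s u] be the function [y |-> E u(y + s Z)] with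
    [Z] standard normal. These operators form a semigroup in the variance
    ([gauss_op_semigroup]), so the Gaussian of variance 1 can be split into
    pieces with the variances of the [X_i], and [E f(W)] is carried to [E f(Z)]
    by exchanging one [X_i] at a time for its Gaussian piece
    ([lindeberg_telescope]). When the second order Taylor remainder of [f] at
    distance [h] is at most [M min(h^2, |h|^3)], an exchange costs little
    ([lindeberg_step]), because [X_i] and its piece have the same mean and
    variance. The test functions are integrated quadratic B-splines
    ([smooth_step]), for which such bounds are polynomial inequalities. They
    squeeze the indicator of a half-line, and the distribution function of [W]
    differs from the normal one by at most the explicit bound of
    [normal_approximation_row]. *)

Set Implicit Arguments.
Unset Strict Implicit.

Import Order.TTheory GRing.Theory Num.Theory.
Import numFieldNormedType.Exports.

Local Open Scope classical_set_scope.
Local Open Scope ring_scope.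

(** * Real integrals on a probability space *)

Section expectation_tools.
Context {R : realType} {d : measure_display} {T : measurableType d}.
Variable P : probability T R.
Implicit Types f g : T -> R.

Local Notation L1 f := (P.-integrable setT (EFin \o f)).

Lemma L1_measurable f : L1 f -> measurable_fun setT f.
Proof. by move=> /integrableP[/measurable_EFinP]. Qed.

Lemma L1_le f g : measurable_fun setT f -> L1 g ->
  (forall t, `|f t| <= g t) -> L1 f.
Proof.
move=> mf ig fg; apply: le_integrable ig => //; first exact/measurable_EFinP.
by move=> t _ /=; rewrite lee_fin (le_trans (fg t))// ler_norm.
Qed.

Lemma L1_cst r : L1 (cst r).
Proof. exact: finite_measure_integrable_cst. Qed.

Lemma L1D f g : L1 f -> L1 g -> L1 (f \+ g).
Proof. by move=> If Ig; exact: (integrableD measurableT If Ig). Qed.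

Lemma L1B f g : L1 f -> L1 g -> L1 (f \- g).
Proof. by move=> If Ig; exact: (integrableB measurableT If Ig). Qed.

Lemma L1Z r f : L1 f -> L1 (fun t => r * f t).
Proof. by move=> If; exact: (integrableZl measurableT r If). Qed.

Lemma L1_sum (I : Type) (s : seq I) (Q : pred I) (f : I -> T -> R) :
  (forall i, L1 (f i)) -> L1 (fun t => \sum_(i <- s | Q i) f i t).
Proof.
move=> If; have := @integrable_sum _ _ _ P setT measurableT I s Q
  (fun i => EFin \o f i) (fun i _ => If i).
by apply: eq_integrable => // t _ /=; rewrite sumEFin.
Qed.

Lemma L1_bounded f M : measurable_fun setT f -> (forall t, `|f t| <= M) -> L1 f.
Proof. by move=> mf fM; apply: (L1_le mf (L1_cst M)). Qed.

Lemma Rintegral_sum (I : Type) (s : seq I) (Q : pred I) (f : I -> T -> R) :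
  (forall i, L1 (f i)) ->
  \int[P]_t (\sum_(i <- s | Q i) f i t) = \sum_(i <- s | Q i) \int[P]_t f i t.
Proof.
move=> If; elim: s => [|i s IH].
  under eq_Rintegral do rewrite big_nil.
  by rewrite big_nil Rintegral_cst// mul0r.
under eq_Rintegral do rewrite big_cons.
rewrite big_cons; case: ifP => Qi //.
by rewrite RintegralD// ?IH//; exact: L1_sum.
Qed.

Lemma Rintegral_prob_cst r : \int[P]_t (cst r t) = r.
Proof.
by rewrite Rintegral_cst//= [X in fine X](@probability_setT _ _ _ P) mulr1.
Qed.

Lemma Rintegral_indic (A : set T) : measurable A ->
  \int[P]_t \1_A t = fine (P A).
Proof. by move=> mA; rewrite /Rintegral integral_indic// setIT. Qed.

(** [|f| <= 1 + f ^+ 2]. *)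
Lemma L1_of_sqr f : measurable_fun setT f -> L1 (fun t => f t ^+ 2) -> L1 f.
Proof.
move=> mf If; apply: (L1_le mf (L1D (L1_cst 1) If)) => t /=.
have := sqr_ge0 (`|f t| - 1); rewrite sqrrB real_normK ?num_real//.
have := normr_ge0 (f t); lra.
Qed.

Lemma L1_mulbnd f g : measurable_fun setT g -> (forall t, `|g t| <= 1) ->
  L1 f -> L1 (f \* g).
Proof.
move=> mg g1 If; have mf := L1_measurable If.
apply: (L1_le _ (integrable_norm If)) => [|t /=]; first exact: measurable_funM.
by rewrite normrM ler_piMr.
Qed.

Lemma L1_sqrD f g : measurable_fun setT f -> measurable_fun setT g ->
  L1 (fun t => f t ^+ 2) -> L1 (fun t => g t ^+ 2) ->
  L1 (fun t => (f t + g t) ^+ 2).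
Proof.
move=> mf mg If Ig; apply: (L1_le _ (L1D (L1Z 2 If) (L1Z 2 Ig))) => [|t /=].
  by apply: measurable_funX; exact: measurable_funD.
rewrite ger0_norm ?sqr_ge0//; have := sqr_ge0 (f t - g t); nra.
Qed.

End expectation_tools.

(** * Independence *)

Definition indep_pair {R : realType} {d} {T : measurableType d}
    (P : probability T R) (Y X : T -> R) : Prop :=
  forall A B, measurable A -> measurable B ->
    P (Y @^-1` A `&` X @^-1` B) = (P (Y @^-1` A) * P (X @^-1` B))%E.

(** A pi-system that generates the sigma-algebra of the block [X_j, j in J].
    Through [g_sigma_algebraType (cylinders X J)], being determined by the
    block becomes measurability on a type, and follows from the usual
    closure lemmas. *)
Definition cylinders {R : realType} {d} {T : measurableType d} {I : finType}
    (X : I -> T -> R) (J : {set I}) : set (set T) :=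
  [set A | exists B : I -> set R, (forall j, measurable (B j)) /\
     A = \bigcap_(j in [set` J]) (X j @^-1` B j)].

Section independence.
Context {R : realType} {d : measure_display} {T : measurableType d}.
Variable P : probability T R.

Lemma indep_pair_comp (Y X : T -> R) (f : R -> R) :
  measurable_fun setT f -> indep_pair P Y X -> indep_pair P Y (f \o X).
Proof.
move=> mf YX A B mA mB; rewrite comp_preimage; apply: YX => //.
by rewrite -[_ @^-1` _]setTI; exact: mf.
Qed.

Section block.
Context {I : finType} (X : I -> {RV P >-> R}).

Lemma cylinders_measurable (J : {set I}) A :
  cylinders X J A -> measurable A.
Proof.
move=> [B [mB ->]]; apply: fin_bigcap_measurable => //.
move=> j _; exact: measurable_funPTI.
Qed.

Lemma cylindersI (J : {set I}) : setI_closed (cylinders X J).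
Proof.
move=> _ _ [B [mB ->]] [C [mC ->]].
exists (fun j => B j `&` C j); split; first by move=> j; exact: measurableI.
by rewrite -bigcapI; apply: eq_bigcapr => j _; rewrite preimage_setI.
Qed.

Lemma block_measurable (J : {set I}) (j : I) : j \in J ->
  measurable_fun [set: g_sigma_algebraType (cylinders X J)]
    (X j : g_sigma_algebraType (cylinders X J) -> R).
Proof.
move=> jJ _ B mB; rewrite setTI; apply: sub_sigma_algebra.
exists (fun i => if i == j then B else setT); split.
  by move=> i; case: ifP.
apply/seteqP; split => [x Bx i _ /=|x /(_ j jJ)/=]; last by rewrite eqxx.
by case: eqP => // ->.
Qed.

(** For a fixed event of [X i], both sides of the product formula are finite
    measures in the event of the block; they agree on the cylinders by
    hypothesis, hence on the sigma-algebra that these generate. *)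
Lemma indep_block (J : {set I}) (i : I) (Y : T -> R) :
  mutually_independent X -> i \notin J ->
  measurable_fun [set: g_sigma_algebraType (cylinders X J)]
    (Y : g_sigma_algebraType (cylinders X J) -> R) ->
  indep_pair P Y (X i).
Proof.
move=> indX iJ mY A B mA mB.
have mXB : measurable (X i @^-1` B) by exact: measurable_funPTI.
(* both sides as measures in the event of the block *)
pose p : {nonneg R} := NngNum (fine_ge0 (measure_ge0 P (X i @^-1` B))).
have pE : p%:num%:E = P (X i @^-1` B) by rewrite /= fineK// fin_num_measure.
pose m1 : {measure set T -> \bar R} := mrestr P mXB.
pose m2 : {measure set T -> \bar R} := mscale p P.
rewrite muleC -pE -[LHS]/(m1 _) -[RHS]/(m2 _).
apply: (@g_sigma_algebra_measure_unique _ _ _ (cylinders X J) _ (fun=> setT)).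
- exact: cylinders_measurable.
- move=> n; exists (fun=> setT); split => //.
  by apply/seteqP; split.
- by rewrite bigcup_const//; exists 0%N.
- exact: cylindersI.
- move=> _ [C [mC ->]].
  rewrite /m1 /m2 /= /mrestr /mscale /=.
  pose C' j := if j == i then B else C j.
  have mC' j : measurable (C' j) by rewrite /C'; case: ifP.
  have C'i : C' i = B by rewrite /C' eqxx.
  have C'J j : j \in J -> C' j = C j.
    by rewrite /C'; case: eqP => // ->; rewrite (negPf iJ).
  have := indX (i |: J) C' (fun j _ => mC' j).
  rewrite big_setU1//= C'i.
  rewrite (eq_bigr _
    (fun j jJ => congr1 (fun D => P (X j @^-1` D)) (C'J j jJ))).
  rewrite -(indX J C (fun j _ => mC j)) -pE => <-.
  congr (P _); apply/seteqP; split => x /=.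
    move=> [h1 h2] j /=; rewrite !inE => /predU1P[->|jJ]; first by rewrite C'i.
    by rewrite C'J//; exact: h1.
  move=> h; split; last by rewrite -C'i; apply: h; rewrite /= setU11.
  by move=> j /= jJ; rewrite -C'J//; apply: h; rewrite /= setU1r.
- by move=> k; rewrite /= /m1 /= /mrestr setTI ltey_eq fin_num_measure.
- by have := mY measurableT _ mA; rewrite setTI.
Qed.

End block.

Section law.
Variables (Y X : {mfun T >-> R}).
Hypothesis YX_indep : indep_pair P Y X.

Let pairYX t := (Y t, X t).

Let measurable_pairYX : measurable_fun setT pairYX.
Proof. exact: measurable_fun_pair. Qed.

HB.instance Definition _ := isMeasurableFun.Build _ _ _ _ pairYX measurable_pairYX.

(** Independence says that the law of the pair agrees with the product of
    the marginal laws on rectangles, which characterises the product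
    measure. *)
Lemma indep_pair_law A : measurable A ->
  (distribution P Y \x distribution P X)%E A = distribution P pairYX A.
Proof.
apply: product_measure_unique => B C mB mC.
by rewrite /distribution /pushforward -YX_indep.
Qed.

Local Open Scope ereal_scope.

Lemma indep_pair_fubini_tonelli (f : R * R -> \bar R) :
  measurable_fun setT f -> (forall z, 0 <= f z) ->
  \int[P]_t f (Y t, X t) = \int[P]_t \int[P]_s f (Y t, X s).
Proof.
move=> mf f0.
rewrite -[LHS](@ge0_integral_distribution _ _ _ _ _ P pairYX f)//.
rewrite -(eq_measure_integral _ (fun A mA _ => indep_pair_law mA)).
rewrite fubini_tonelli1// ge0_integral_distribution//=; first last.
- by move=> y; exact: integral_ge0.
- exact: measurable_fun_fubini_tonelli_F.
apply: eq_integral => t _ /=; rewrite /fubini_F ge0_integral_distribution//.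
exact: measurableT_comp.
Qed.

Lemma indep_mfun_integrableM :
  P.-integrable setT (EFin \o Y) -> P.-integrable setT (EFin \o X) ->
  P.-integrable setT (EFin \o (Y \* X)%R).
Proof.
move=> iY iX; apply/integrableP; split.
  by apply/measurable_EFinP; exact: measurable_funM.
pose f : R * R -> \bar R := EFin \o (fun z => `|z.1 * z.2|)%R.
rewrite (eq_integral (f \o pairYX))//.
have mf : measurable_fun setT f.
  by apply/measurable_EFinP/measurableT_comp => //; exact: measurable_funM.
rewrite indep_pair_fubini_tonelli//; last by move=> z; rewrite /f/= lee_fin.
have /integrableP[mX fX] := iX; have /integrableP[mY fY] := iY.
have fE t : \int[P]_s f (Y t, X s) = `|(Y t)%:E| * \int[P]_s `|(X s)%:E|.
  rewrite -ge0_integralZl//; last exact: measurableT_comp.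
  by apply: eq_integral => s _; rewrite /f /= normrM EFinM.
under eq_integral do rewrite fE.
rewrite ge0_integralZr//; last 2 first.
- exact: measurableT_comp.
- exact: integral_ge0.
apply: lte_mul_pinfty => //; first exact: integral_ge0.
by rewrite ge0_fin_numE// integral_ge0.
Qed.

Lemma indep_mfun_RintegralM :
  P.-integrable setT (EFin \o Y) -> P.-integrable setT (EFin \o X) ->
  (\int[P]_t (Y t * X t) = \int[P]_t Y t * \int[P]_t X t)%R.
Proof.
move=> iY iX; pose f : R * R -> \bar R := EFin \o (fun z => z.1 * z.2)%R.
have mf : measurable_fun setT f by apply/measurable_EFinP; exact: measurable_funM.
have iYX := indep_mfun_integrableM iY iX.
have law := indep_pair_law.
have intf : (distribution P pairYX).-integrable setT f.
  by apply: integrable_pushforward.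
have intf' : (distribution P Y \x distribution P X).-integrable setT f.
  apply/integrableP; split => //; have /integrableP[_] := intf.
  by rewrite (eq_measure_integral _ (fun A mA _ => law _ mA)).
rewrite /Rintegral.
rewrite -[X in fine X = _](@integral_distribution _ _ _ _ _ P pairYX f)//.
rewrite -(eq_measure_integral _ (fun A mA _ => law _ mA)).
rewrite -integral12_prod_meas1//.
have idX : (distribution P X).-integrable setT EFin.
  by apply: integrable_pushforward => //; exact/measurable_EFinP.
have idY : (distribution P Y).-integrable setT EFin.
  by apply: integrable_pushforward => //; exact/measurable_EFinP.
have XE : \int[distribution P X]_x x%:E = \int[P]_t (X t)%:E.
  by rewrite integral_distribution//; exact/measurable_EFinP.
have YE : \int[distribution P Y]_x x%:E = \int[P]_t (Y t)%:E.
  by rewrite integral_distribution//; exact/measurable_EFinP.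
have fX : \int[P]_t (X t)%:E \is a fin_num by exact: integrable_fin_num iX.
have fY : \int[P]_t (Y t)%:E \is a fin_num by exact: integrable_fin_num iY.
rewrite -fineM// -XE -YE; congr fine.
rewrite -[X in _ = _ * X]fineK ?XE// -integralZr//.
apply: eq_integral => y _; rewrite /fubini_F /f/=.
under eq_integral do rewrite EFinM.
by rewrite integralZl// fineK ?XE.
Qed.

End law.

End independence.

Section independent_products.
Context {R : realType} {d : measure_display} {T : measurableType d}.
Variable P : probability T R.
Variables Y X : T -> R.
Hypotheses (ind : indep_pair P Y X).

Local Notation L1 f := (P.-integrable setT (EFin \o f)).

Lemma indep_L1M : L1 Y -> L1 X -> L1 (Y \* X).
Proof.
move=> iY iX; have mY := L1_measurable iY; have mX := L1_measurable iX.
pose Y' : {mfun T >-> R} := HB.pack Y (isMeasurableFun.Build _ _ _ _ _ mY).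
pose X' : {mfun T >-> R} := HB.pack X (isMeasurableFun.Build _ _ _ _ _ mX).
exact: (@indep_mfun_integrableM _ _ _ P Y' X') .
Qed.

Lemma indep_RintegralM : L1 Y -> L1 X ->
  \int[P]_t (Y t * X t) = \int[P]_t Y t * \int[P]_t X t.
Proof.
move=> iY iX; have mY := L1_measurable iY; have mX := L1_measurable iX.
pose Y' : {mfun T >-> R} := HB.pack Y (isMeasurableFun.Build _ _ _ _ _ mY).
pose X' : {mfun T >-> R} := HB.pack X (isMeasurableFun.Build _ _ _ _ _ mX).
exact: (@indep_mfun_RintegralM _ _ _ P Y' X').
Qed.

(** Independence and the vanishing mean of [X] kill the cross term. *)
Lemma indep_Rintegral_sqrD : L1 (fun t => Y t ^+ 2) -> L1 (fun t => X t ^+ 2) ->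
  measurable_fun setT Y -> measurable_fun setT X -> \int[P]_t X t = 0 ->
  \int[P]_t (Y t + X t) ^+ 2 = \int[P]_t Y t ^+ 2 + \int[P]_t X t ^+ 2.
Proof.
move=> iY iX mY mX EX.
have iYX := indep_L1M (L1_of_sqr mY iY) (L1_of_sqr mX iX).
rewrite (@eq_Rintegral _ _ _ _ _
  ((fun t => Y t ^+ 2 + X t ^+ 2) \+ (fun t => 2 * (Y \* X) t))); last first.
  by move=> t _ /=; ring.
rewrite RintegralD//; [|exact: L1D|exact: L1Z].
rewrite RintegralD// RintegralZl// indep_RintegralM; [|exact: L1_of_sqr..].
by rewrite EX !mulr0 addr0.
Qed.

End independent_products.

(** * Lindeberg's condition from the rarity of large entries *)

Lemma finset_ind (I : finType) (Q : {set I} -> Prop) : Q finset.set0 ->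
  (forall (J : {set I}) (i : I), i \notin J -> Q J -> Q (i |: J)) ->
  forall J, Q J.
Proof.
move=> Q0 QS J; have [n] := ubnP #|J|; elim: n J => // n IH J.
have [->//|[i iJ] cJ] := set_0Vmem J.
rewrite -(finset.setD1K iJ); apply: QS; first by rewrite !inE eqxx.
by apply: IH; move: cJ; rewrite (cardsD1 i) iJ.
Qed.

Definition exceed {R : realType} (e : R) : set R := [set x | e < `|x|].

Lemma measurable_exceed {R : realType} (e : R) : measurable (exceed e).
Proof.
rewrite (_ : exceed e = Num.norm @^-1` `]e, +oo[); last first.
  by apply/seteqP; split => x /=; rewrite in_itv/= andbT.
exact: measurable_funPTI.
Qed.

Section row.
Context {R : realType} {d : measure_display} {T : measurableType d}.
Variable P : probability T R.
Context {I : finType} (X : I -> {RV P >-> R}).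
Hypothesis indX : mutually_independent X.
Hypothesis sqrX : forall i, P.-integrable setT (EFin \o (fun t => X i t ^+ 2)).
Hypothesis meanX : forall i, \int[P]_t X i t = 0.

Local Notation L1 f := (P.-integrable setT (EFin \o f)).

Definition partial_sum (J : {set I}) (t : T) : R := \sum_(j in J) X j t.

Lemma L1X i : L1 (X i).
Proof. by apply: L1_of_sqr. Qed.

Lemma L1_partial_sum J : L1 (partial_sum J).
Proof. by apply: L1_sum => j; exact: L1X. Qed.

Lemma measurable_partial_sum J : measurable_fun setT (partial_sum J).
Proof. exact/L1_measurable/L1_partial_sum. Qed.

(** The entries outside [J] are replaced by 0, so that every term of the sum
    over the whole index type is determined by the block. *)
Lemma block_measurable_partial_sum (J : {set I}) :
  measurable_fun [set: g_sigma_algebraType (cylinders X J)]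
    (partial_sum J : g_sigma_algebraType (cylinders X J) -> R).
Proof.
rewrite (_ : partial_sum J = fun t => \sum_j (if j \in J then X j t else 0)).
  2: by apply/funext => t; rewrite /partial_sum big_mkcond.
apply: measurable_sum => j.
case: (boolP (j \in J)) => jJ; last exact: measurable_cst.
exact: block_measurable.
Qed.

Lemma indep_partial_sum (J : {set I}) i : i \notin J ->
  indep_pair P (partial_sum J) (X i).
Proof.
by move=> iJ; apply: indep_block iJ _ => //; exact: block_measurable_partial_sum.
Qed.

Lemma partial_sum_setU1 (J : {set I}) i t : i \notin J ->
  partial_sum (i |: J) t = partial_sum J t + X i t.
Proof. by move=> iJ; rewrite /partial_sum big_setU1//= addrC. Qed.

Lemma partial_sum0 t : partial_sum finset.set0 t = 0.
Proof. by rewrite /partial_sum big_set0. Qed.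

Lemma partial_sum_sqr J : L1 (fun t => partial_sum J t ^+ 2) /\
  \int[P]_t partial_sum J t ^+ 2 = \sum_(j in J) \int[P]_t X j t ^+ 2.
Proof.
elim/finset_ind: J => [|J i iJ [i2 e2]].
  rewrite big_set0 (_ : (fun _ => _) = cst 0); last first.
    by apply/funext => t; rewrite partial_sum0 expr0n.
  by split; [exact: L1_cst|rewrite Rintegral_prob_cst].
rewrite (_ : (fun _ => _) = fun t => (partial_sum J t + X i t) ^+ 2); last first.
  by apply/funext => t; rewrite partial_sum_setU1.
split; first exact: (L1_sqrD (measurable_partial_sum _)).
rewrite (indep_Rintegral_sqrD (indep_partial_sum iJ))//.
  by rewrite e2 big_setU1//= addrC.
exact: measurable_partial_sum.
Qed.

Lemma mean_partial_sum J : \int[P]_t partial_sum J t = 0.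
Proof.
by rewrite Rintegral_sum ?big1// => j; exact: L1X.
Qed.

Section truncation.
Variable e : R.
Hypotheses (e_gt0 : 0 < e) (e_le1 : e <= 1).

Let A : set R := exceed e.
Let others i : {set I} := [set~ i]%SET.
Let C i : set T := [set t | forall j, j != i -> `|X j t| <= e].
Let V i := partial_sum (others i).

Definition exceeding : set T := [set t | exists i, e < `|X i t|].

Let mA : measurable A. Proof. exact: measurable_exceed. Qed.

Let bmC i : measurable (C i : set (g_sigma_algebraType (cylinders X (others i)))).
Proof.
rewrite (_ : C i = \bigcap_(j in [set` others i]) (X j @^-1` ~` A)).
  apply: sub_sigma_algebra; exists (fun=> ~` A); split => // _; exact: measurableC.
apply/seteqP; split => t Ct j.
  rewrite /= /others !inE => ji; rewrite /A /exceed /= ltNge => /negP; apply.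
  exact: Ct.
move=> ji; have := Ct j; rewrite /= /others !inE => /(_ ji).
by rewrite /A /exceed/= => /negP; rewrite -leNgt.
Qed.

Let mC i : measurable (C i).
Proof.
have sub := @smallest_sub _ (sigma_algebra [set: T]) (cylinders X (others i))
  (@measurable _ T).
have h : <<s cylinders X (others i) >> (C i) by exact: bmC.
apply: (sub _ _ _ h); first exact: sigma_algebra_measurable.
by move=> B; exact: cylinders_measurable.
Qed.

Let block_indep i (Y : T -> R) :
  measurable_fun [set: g_sigma_algebraType (cylinders X (others i))]
    (Y : g_sigma_algebraType (cylinders X (others i)) -> R) ->
  indep_pair P Y (X i).
Proof. by apply: indep_block => //; rewrite !inE eqxx. Qed.

Let indC i : indep_pair P (\1_(C i)) (X i).
Proof. by apply: block_indep; exact: measurable_indic. Qed.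

Let indVC i : indep_pair P (V i \* \1_(C i)) (X i).
Proof.
apply: block_indep; apply: measurable_funM; last exact: measurable_indic.
exact: block_measurable_partial_sum.
Qed.

Let indV2C i : indep_pair P (fun t => V i t ^+ 2 * \1_(C i) t) (X i).
Proof.
apply: block_indep; apply: measurable_funM; last exact: measurable_indic.
by apply: measurable_funX; exact: block_measurable_partial_sum.
Qed.

Lemma measurable_exceeding : measurable exceeding.
Proof.
rewrite (_ : exceeding = \bigcup_(i in [set: I]) (X i @^-1` A)).
  by apply: fin_bigcup_measurable => // i _; exact: measurable_funPTI.
by apply/seteqP; split => [t [i ti]|t [i _ ti]]; exists i.
Qed.

Let W := partial_sum finset.setT.

Let WE i t : W t = V i t + X i t.
Proof.
rewrite -partial_sum_setU1 ?inE ?eqxx//; congr (partial_sum _ t).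
by apply/setP => j; rewrite !inE; case: eqP.
Qed.

(** At most one entry can be the only one to exceed [e]. *)
Lemma disjoint_excess t :
  \sum_i \1_A (X i t) * \1_(C i) t <= \1_exceeding t :> R.
Proof.
have [[i0 ti0]|nex] := pselect (exceeding t); last first.
  rewrite big1 ?indic_ge0// => i _.
  by rewrite !indicE memNset ?mul0r// => tA; apply: nex; exists i.
rewrite [leRHS]indicE mem_set; last by exists i0.
rewrite (bigD1 i0)//= big1 ?addr0 => [|i ii0].
  by rewrite !indicE; do 2 case: (_ \in _); rewrite ?mulr0 ?mulr1 ?ler01.
rewrite [X in _ * X]indicE memNset ?mulr0// => /(_ i0).
by rewrite eq_sym ii0 leNgt ti0 => /(_ isT).
Qed.

Let g2 (x : R) : R := x ^+ 2 * \1_A x.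
Let g1 (x : R) : R := x * \1_A x.

Let m1A : measurable_fun setT (\1_A : R -> R).
Proof. exact: measurable_indic. Qed.

Let mg2 : measurable_fun setT g2.
Proof. exact: measurable_funM. Qed.

Let mg1 : measurable_fun setT g1.
Proof. exact: measurable_funM. Qed.

Let indic_le1 (U : Type) (B : set U) u : `|\1_B u : R| <= 1.
Proof. by rewrite indicE; case: (_ \in _); rewrite ?normr1 ?normr0 ?ler01. Qed.

Let L1g2 i : L1 (g2 \o X i).
Proof.
apply: (L1_mulbnd (g := fun t => \1_A (X i t)) _ _ (sqrX i)) => //.
exact: measurableT_comp.
Qed.

Let L1g1 i : L1 (g1 \o X i).
Proof.
apply: (L1_mulbnd (g := fun t => \1_A (X i t)) _ _ (L1X i)) => //.
exact: measurableT_comp.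
Qed.

Let L1g0 i : L1 (\1_A \o X i).
Proof.
by apply: (@L1_bounded _ _ _ _ _ 1) => [|t /=]; [exact: measurableT_comp|].
Qed.

Let m1C i : measurable_fun setT (\1_(C i) : T -> R).
Proof. exact: measurable_indic. Qed.

Let L1C i : L1 (\1_(C i)).
Proof. by apply: (@L1_bounded _ _ _ _ _ 1). Qed.

Let L1VC i : L1 (V i \* \1_(C i)).
Proof. by apply: L1_mulbnd => //; exact: L1_partial_sum. Qed.

Let L1V2 i : L1 (fun t => V i t ^+ 2).
Proof. by have [] := partial_sum_sqr (others i). Qed.

Let L1V2C i : L1 (fun t => V i t ^+ 2 * \1_(C i) t).
Proof. exact: (L1_mulbnd _ _ (L1V2 i)). Qed.

Hypothesis W2 : \int[P]_t W t ^+ 2 = 1.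
Hypothesis rare : fine (P exceeding) <= e ^+ 2 / 32.

Let EV2_le1 i : \int[P]_t V i t ^+ 2 <= 1.
Proof.
rewrite -W2; under [leRHS]eq_Rintegral do rewrite (WE i).
rewrite (indep_Rintegral_sqrD (Y := V i))//.
- by rewrite lerDl; apply: Rintegral_ge0 => t _; exact: sqr_ge0.
- by apply: indep_partial_sum; rewrite !inE eqxx.
- exact: measurable_partial_sum.
Qed.

(** If no entry exceeds [e], then [C i] occurs. *)
Let PC i : 1 - fine (P exceeding) <= \int[P]_t \1_(C i) t.
Proof.
rewrite -Rintegral_indic; last exact: measurable_exceeding.
rewrite -[X in X - _](Rintegral_prob_cst P) -RintegralB//; last 2 first.
- exact: L1_cst.
- apply: (@L1_bounded _ _ _ _ _ 1) => //.
  exact/measurable_indic/measurable_exceeding.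
apply: le_Rintegral => //.
- apply: L1B; first exact: L1_cst.
  apply: (@L1_bounded _ _ _ _ _ 1) => //.
  exact/measurable_indic/measurable_exceeding.
- move=> t _ /=; rewrite !indicE.
  have [tC|/negP tC] := boolP (t \in C i).
    by rewrite lerBlDr lerDl; case: (_ \in _).
  suff -> : t \in exceeding by rewrite subrr.
  apply/mem_set; apply: contrapT => nex; apply: tC; apply/mem_set => j _.
  by rewrite leNgt; apply/negP => tj; apply: nex; exists j.
Qed.

(** As [V i] has mean zero, its integral over [C i] is the opposite of its
    integral over the complement, which is contained in [exceeding]. There
    [|v| <= e / 8 * v ^+ 2 + 2 / e] bounds the integrand; the weight [e / 8]
    makes the first term absorbable in [single_excess]. *)
Let EVC i : `|\int[P]_t (V i \* \1_(C i)) t| <=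
  e / 8 + 2 * fine (P exceeding) / e.
Proof.
have mE := measurable_exceeding.
have L1E : L1 (\1_exceeding).
  by apply: (@L1_bounded _ _ _ _ _ 1) => //; exact: measurable_indic.
pose D := ~` C i; have mD : measurable D by exact: measurableC.
have L1VD : L1 (V i \* \1_D).
  by apply: L1_mulbnd => //; exact: L1_partial_sum.
have -> : \int[P]_t (V i \* \1_(C i)) t = - \int[P]_t (V i \* \1_D) t.
  apply/eqP; rewrite -addr_eq0 -RintegralD//; apply/eqP.
  rewrite -[RHS](mean_partial_sum (others i)); apply: eq_Rintegral => t _ /=.
  by rewrite -mulrDr !indicE /D in_setC; case: (t \in C i);
    rewrite ?addr0 ?add0r ?mulr1.
rewrite normrN (le_trans (le_normr_Rintegral _ _))//.
apply: (@le_trans _ _ (\int[P]_t (e / 8 * V i t ^+ 2 + 2 / e * \1_exceeding t))).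
  apply: le_Rintegral => //.
  - exact: (integrable_norm L1VD).
  - by apply: L1D; exact: L1Z.
  - move=> t _ /=; rewrite [\1_D t]indicE; have [tD|tD] := boolP (t \in D).
      have -> : \1_exceeding t = 1 :> R.
        rewrite indicE mem_set//; apply: contrapT => nex.
        move/set_mem : tD; apply => j _.
        by rewrite leNgt; apply/negP => tj; apply: nex; exists j.
      rewrite !mulr1 -(real_normK (num_real (V i t))).
      rewrite -(ler_pM2l e_gt0) mulrDr [e * (2 / e)]mulrC divfK ?gt_eqF//.
      have := sqr_ge0 (e * `|V i t| / 4 - 1); nra.
    rewrite mulr0 normr0 addr_ge0// mulr_ge0// ?sqr_ge0 ?divr_ge0 ?ltW//.
rewrite RintegralD//; [|exact: L1Z..].
rewrite !RintegralZl// Rintegral_indic//.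
rewrite [2 / e * _]mulrAC lerD2r ler_piMr// divr_ge0// ltW//.
Qed.

(** Expand [W = V i + X i] and separate each term by independence. The
    square of [V i] contributes a nonnegative amount; the main term keeps a
    factor of at least [1 - 1 / 32], and the cross term is at most [2 * (3 /
    16)] of the mean of [g2 (X i)]. *)
Let single_excess i :
  2^-1 * \int[P]_t g2 (X i t) <=
  \int[P]_t (W t ^+ 2 * (\1_A (X i t) * \1_(C i) t)).
Proof.
set l := \int[P]_t g2 (X i t).
have mX : measurable_fun setT (X i) by [].
have l_ge0 : 0 <= l.
  by apply: Rintegral_ge0 => t _; rewrite /g2 indicE mulr_ge0 ?sqr_ge0.
pose f2 t := \1_(C i) t * (g2 \o X i) t.
pose f1 t := (V i \* \1_(C i)) t * (g1 \o X i) t.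
pose f0 t := (V i t ^+ 2 * \1_(C i) t) * (\1_A \o X i) t.
have L1f2 : L1 f2 by apply: indep_L1M => //; apply: indep_pair_comp.
have L1f1 : L1 f1 by apply: indep_L1M => //; apply: indep_pair_comp.
have L1f0 : L1 f0 by apply: indep_L1M => //; apply: indep_pair_comp.
have -> : \int[P]_t (W t ^+ 2 * (\1_A (X i t) * \1_(C i) t)) =
  \int[P]_t (f2 t + 2 * f1 t + f0 t).
  apply: eq_Rintegral => t _; rewrite (WE i) /f2 /f1 /f0 /g2 /g1 /=.
  ring.
rewrite RintegralD//; last by apply: L1D => //; exact: L1Z.
rewrite RintegralD//; last exact: L1Z.
rewrite RintegralZl//.
rewrite {1}/f2 indep_RintegralM//; last exact: indep_pair_comp.
rewrite {1}/f1 indep_RintegralM//; last exact: indep_pair_comp.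
have f0_ge0 : 0 <= \int[P]_t f0 t.
  apply: Rintegral_ge0 => t _; rewrite /f0 /= !indicE.
  by apply: mulr_ge0 => //; apply: mulr_ge0 => //; exact: sqr_ge0.
have Eg1 : `|\int[P]_t (g1 \o X i) t| <= l / e.
  rewrite (le_trans (le_normr_Rintegral _ _))//.
  rewrite ler_pdivlMr// -RintegralZr//; last exact: integrable_norm.
  apply: le_Rintegral => //.
  - have := L1Z e (integrable_norm (L1g1 i)).
    by apply: eq_integrable => // s _ /=; rewrite mulrC.
  - exact: L1g2.
  - move=> t _ /=; rewrite /g1 /g2 indicE normrM.
    have [/set_mem|_] := boolP (X i t \in A); last by rewrite normr0 !mulr0 mul0r.
    rewrite /A /exceed/= => /ltW eX; rewrite normr1 !mulr1.
    by rewrite -(real_normK (num_real (X i t))) expr2 ler_wpM2l.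
set c := \int[P]_t \1_(C i) t; set v := \int[P]_t (V i \* _) t.
set m := \int[P]_t (g1 \o _) _.
pose del := fine (P exceeding).
have cl : (1 - del) * l <= c * l by rewrite ler_wpM2r// PC.
have vm : `|v * m| <= (e / 8 + 2 * del / e) * (l / e).
  by rewrite normrM ler_pM// EVC.
have del_le : del / e ^+ 2 <= 32^-1 by rewrite ler_pdivrMr ?exprn_gt0// mulrC.
have e2_le1 : del <= 32^-1.
  rewrite (le_trans rare)// ler_piMl ?invr_ge0// expr_le1// ltW//.
have {}vm : `|v * m| <= (3 / 16) * l.
  apply: (le_trans vm); rewrite (_ : _ * _ = (8^-1 + 2 * (del / e ^+ 2)) * l).
    by rewrite ler_wpM2r//; lra.
  by field; rewrite gt_eqF.
have := ler_norm (- (v * m)); rewrite normrN => vm'.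
have del_l : del * l <= 32^-1 * l by rewrite ler_wpM2r.
move: cl vm vm' f0_ge0 del_l; rewrite mulrBl mul1r.
set q := v * m; set cl := c * l; set dl := del * l => *; lra.
Qed.

(** Sum [single_excess] over [i], using that the events in which a single
    entry exceeds [e] are disjoint parts of [exceeding]. *)
Lemma lindeberg_of_rare_excess :
  \sum_i \int[P]_t g2 (X i t) <= 2 * \int[P]_t (W t ^+ 2 * \1_exceeding t).
Proof.
have L1W : L1 (fun t => W t ^+ 2) by have [] := partial_sum_sqr finset.setT.
have m1E : measurable_fun setT (\1_exceeding : T -> R).
  by apply: measurable_indic; exact: measurable_exceeding.
have L1i i : L1 (fun t => W t ^+ 2 * (\1_A (X i t) * \1_(C i) t)).
  apply: (L1_mulbnd _ _ L1W) => [|t].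
    by apply: measurable_funM => //; exact: measurableT_comp.
  by rewrite normrM mulr_ile1.
rewrite -ler_pdivrMl// mulr_sumr.
apply: (@le_trans _ _ (\sum_i \int[P]_t (W t ^+ 2 * (\1_A (X i t) * \1_(C i) t)))).
  by apply: ler_sum => i _; exact: single_excess.
rewrite -Rintegral_sum//; apply: le_Rintegral => //.
- exact: L1_sum.
- exact: (L1_mulbnd _ _ L1W).
- move=> t _; rewrite -mulr_sumr ler_wpM2l ?sqr_ge0//; exact: disjoint_excess.
Qed.

End truncation.
End row.

(** * The standard normal law *)

Section gaussian.
Context {R : realType}.
Local Notation mu := (@lebesgue_measure R).
Local Notation N := (@normal_prob R 0 1).
Local Notation phi := (@normal_pdf R 0 1).

Lemma normal_pdf01E x : phi x = normal_peak 1 * expR (- x ^+ 2 / 2).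
Proof. by rewrite normal_pdfE ?oner_neq0// /normal_fun subr0 expr1n mulr2n. Qed.

(** The Radon-Nikodym derivative of the normal law is almost everywhere
    equal to the density that defines it. *)
Lemma ge0_integral_normal (f : R -> \bar R) :
  measurable_fun setT f -> (forall x, 0 <= f x)%E ->
  (\int[N]_x f x = \int[mu]_x (f x * (phi x)%:E))%E.
Proof.
move=> mf f0; have dom := @normal_prob_dominates R 0 1.
rewrite -(Radon_Nikodym_SigmaFinite.change_of_variables dom)//.
apply: ae_eq_integral => //.
- apply: emeasurable_funM => //.
  exact: measurable_int (Radon_Nikodym_SigmaFinite.f_integrable dom).
- apply: emeasurable_funM => //; apply/measurable_EFinP.
  exact: measurable_normal_pdf.
- apply: ae_eqe_mul2l; apply: integral_ae_eq => //.
  + exact: Radon_Nikodym_SigmaFinite.f_integrable.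
  + by apply/measurable_EFinP; exact: measurable_normal_pdf.
  + by move=> E _ mE; rewrite -Radon_Nikodym_SigmaFinite.f_integral.
Qed.

Lemma ge0_integral_affine (a c : R) (G : R -> R) : 0 < a -> continuous G ->
  (forall x, 0 <= G x) ->
  (\int[mu]_x (G x)%:E = \int[mu]_x (a * G (a * (x - c)))%:E)%E.
Proof.
move=> a0 cG G0; pose F (x : R^o) : R^o := a * (x - c).
have dF (x : R^o) : is_derive x 1 F a.
  by rewrite /F; apply: is_derive_eq; rewrite subr0 scaler1.
have F'E : F^`()%classic = cst a.
  by apply/funext => x; rewrite derive1E derive_val.
rewrite (@increasing_ge0_integration_by_substitutionT _ F G)//.
- by apply: eq_integral => x _; rewrite F'E /= mulrC.
- by move=> x y xy; rewrite ltr_pM2l// ltrD2r.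
- by rewrite F'E => x; exact: cvg_cst.
- by rewrite F'E; exact: is_cvg_cst.
- by rewrite F'E; exact: is_cvg_cst.
- by apply: gt0_cvgMrNy => //; exact: cvg_addrr_Ny.
- by apply: gt0_cvgMry => //; exact: cvg_addrr.
Qed.

Lemma continuous_normal_pdf01 : continuous phi.
Proof. by apply: continuous_normal_pdf; rewrite oner_neq0. Qed.

(** With [w = (r * y - s * z) / t] and [v = (r * z - s * y) / t] one has [w
    ^+ 2 + z ^+ 2 = y ^+ 2 + v ^+ 2]: the standard Gaussian density of the
    plane is invariant under rotations. *)
Lemma normal_pdf_rotation (s t r y z : R) : 0 < t -> 0 < r ->
  r ^+ 2 = s ^+ 2 + t ^+ 2 ->
  phi (r / t * (y - s / r * z)) * phi z = phi y * phi (r / t * (z - s / r * y)).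
Proof.
move=> t0 r0 rst; rewrite !normal_pdf01E mulrACA [RHS]mulrACA -!expRD.
congr (_ * expR _); apply/eqP; rewrite -subr_eq0.
have [t_neq0 r_neq0] : t != 0 /\ r != 0 by rewrite !gt_eqF.
rewrite (_ : _ - _ = (y ^+ 2 - z ^+ 2) * (s ^+ 2 + t ^+ 2 - r ^+ 2) / (2 * t ^+ 2)).
  by rewrite rst subrr mulr0 mul0r.
by field; rewrite t_neq0 r_neq0.
Qed.

Section convolution.
Variables (s t r : R) (f : R -> R).
Hypotheses (t0 : 0 < t) (r0 : 0 < r) (rst : r ^+ 2 = s ^+ 2 + t ^+ 2).
Hypotheses (cf : continuous f) (f0 : forall x, 0 <= f x).
Let a := r / t.
Let a0 : 0 < a. Proof. exact: divr_gt0. Qed.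

(** A combination [s * Z + t * Z'] of independent standard normal variables
    is distributed as [r * Z]. Substitute [w = (r * y - s * z) / t] in the
    inner integral, exchange the integrals, and use [normal_pdf_rotation]:
    the integral over [z] that remains is that of a density, and equals 1. *)
Lemma normal_convolution :
  (\int[N]_z \int[N]_w (f (s * z + t * w))%:E = \int[N]_y (f (r * y))%:E)%E.
Proof.
have r_neq0 : r != 0 by rewrite gt_eqF.
have t_neq0 : t != 0 by rewrite gt_eqF.
have mf : measurable_fun setT f by exact: continuous_measurable_fun.
have mphi := @measurable_normal_pdf R 0 1.
have cont_lin (c1 c2 : R) : continuous (fun w : R => c1 + c2 * w).
  by move=> w; apply: cvgD; [exact: cvg_cst|apply: cvgMr; exact: cvg_id].
have inner z : (\int[N]_w (f (s * z + t * w))%:E =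
    \int[mu]_y (f (r * y) * (a * phi (a * (y - s / r * z))))%:E)%E.
  rewrite ge0_integral_normal//; last 2 first.
  - apply/measurable_EFinP/measurableT_comp => //.
    by apply: measurable_funD => //; exact: measurable_funM.
  - by move=> w; rewrite lee_fin.
  under eq_integral do rewrite -EFinM.
  rewrite (@ge0_integral_affine a (s / r * z)
    (fun w => f (s * z + t * w) * phi w)) ?a0//; last 2 first.
  - move=> w; apply: cvgM; last exact: continuous_normal_pdf01.
    by apply: continuous_comp; [exact: cont_lin|exact: cf].
  - by move=> w; rewrite mulr_ge0 ?normal_pdf_ge0.
  apply: eq_integral => y _; rewrite mulrCA; congr (f _ * _)%:E.
  by rewrite /a; field; rewrite t_neq0 r_neq0.
rewrite ge0_integral_normal//; last 2 first.
- pose h : R * R -> \bar R := EFin \o (fun zw => f (s * zw.1 + t * zw.2)).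
  apply: (@measurable_fun_fubini_tonelli_F _ _ _ _ _ N h).
    apply/measurable_EFinP/measurableT_comp => //.
    by apply: measurable_funD; exact: measurable_funM.
  by move=> x; rewrite lee_fin.
- by move=> x; apply: integral_ge0 => w _; rewrite lee_fin.
pose K (z y : R) : R := f (r * y) * (a * (phi y * phi (a * (z - s / r * y)))).
have mK : measurable_fun setT (EFin \o (fun zy : R * R => K zy.1 zy.2)).
  apply/measurable_EFinP/measurable_funM.
    by apply: measurableT_comp => //; exact: measurable_funM.
  apply: measurable_funM => //; apply: measurable_funM.
    exact: measurableT_comp.
  apply: measurableT_comp => //; apply: measurable_funM => //.
  by apply: measurable_funB => //; exact: measurable_funM.
have K0 z y : 0 <= K z y.
  apply: mulr_ge0 => //; apply: mulr_ge0; first exact: ltW.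
  by apply: mulr_ge0; exact: normal_pdf_ge0.
transitivity (\int[mu]_z \int[mu]_y (K z y)%:E)%E.
  apply: eq_integral => z _; rewrite inner muleC.
  transitivity (\int[mu]_y ((phi z)%:E *
      (f (r * y) * (a * phi (a * (y - s / r * z))))%:E))%E; last first.
    apply: eq_integral => y _; rewrite -EFinM /K -normal_pdf_rotation//.
    by congr _%:E; rewrite -/a; ring.
  rewrite ge0_integralZl//.
  - apply/measurable_EFinP/measurable_funM.
      by apply: measurableT_comp => //; exact: measurable_funM.
    apply: measurable_funM => //; apply: measurableT_comp => //.
    by apply: measurable_funM => //; exact: measurable_funB.
  - move=> y _; rewrite lee_fin; apply: mulr_ge0 => //; apply: mulr_ge0.
      exact: ltW.
    exact: normal_pdf_ge0.
  - by rewrite lee_fin normal_pdf_ge0.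
rewrite (@fubini_tonelli _ _ _ _ _ mu mu _ mK)/=; last first.
  by move=> zy; rewrite lee_fin.
rewrite ge0_integral_normal//; last 2 first.
- by apply/measurable_EFinP/measurableT_comp => //; exact: measurable_funM.
- by move=> y; rewrite lee_fin.
apply: eq_integral => y _.
transitivity (\int[mu]_z ((f (r * y) * phi y)%:E *
    (a * phi (a * (z - s / r * y)))%:E))%E.
  by apply: eq_integral => z _; rewrite -EFinM /K; congr _%:E; ring.
rewrite ge0_integralZl//.
- rewrite -(ge0_integral_affine _ a0)//.
  + by rewrite integral_normal_pdf mule1 EFinM.
  + exact: continuous_normal_pdf01.
  + exact: normal_pdf_ge0.
- apply/measurable_EFinP/measurable_funM => //; apply: measurableT_comp => //.
  by apply: measurable_funM => //; exact: measurable_funB.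
- by move=> z _; rewrite lee_fin mulr_ge0 ?normal_pdf_ge0// ltW.
- by rewrite lee_fin mulr_ge0 ?normal_pdf_ge0.
Qed.

End convolution.

Section moments.

Lemma expR_quarter_ge (z : R) : z ^+ 4 / 64 <= expR (z ^+ 2 / 4).
Proof.
have -> : z ^+ 2 / 4 = z ^+ 2 / 8 + z ^+ 2 / 8 by lra.
have h := expR_ge1Dx (z ^+ 2 / 8); rewrite expRD.
have z20 := sqr_ge0 z.
have -> : z ^+ 4 / 64 = (z ^+ 2 / 8) * (z ^+ 2 / 8) by field.
by rewrite ler_pM//; lra.
Qed.

(** The cube times the density is dominated by a combination of the centred
    normal densities of variances 1 and 2. *)
Lemma L1_normal_cube : N.-integrable setT (EFin \o (fun z : R => `|z| ^+ 3)).
Proof.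
have m3 : measurable_fun setT (fun z : R => `|z| ^+ 3).
  by apply: measurable_funX; exact: normr_measurable.
apply/integrableP; split; first exact/measurable_EFinP.
rewrite ge0_integral_normal//; last first.
  by apply/measurable_EFinP; exact: measurableT_comp.
(* from [|z| ^+ 3 <= 1 + z ^+ 4 <= 1 + 64 * expR (z ^+ 2 / 4)] *)
pose c : R := normal_peak 1 * 64 / normal_peak (Num.sqrt 2).
have s2 : Num.sqrt 2 != 0 :> R by rewrite gt_eqF// sqrtr_gt0.
have c0 : 0 <= c by rewrite /c divr_ge0 ?mulr_ge0 ?normal_peak_ge0.
have mpdfE (m v : R) : measurable_fun setT (fun z : R => (normal_pdf m v z)%:E).
  by apply/measurable_EFinP; apply: measurable_normal_pdf.
apply: (@le_lt_trans _ _
    (\int[mu]_z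
      ((phi z)%:E + c%:E * (normal_pdf 0 (Num.sqrt 2) z)%:E))%E); last first.
  rewrite ge0_integralD//.
  - rewrite ge0_integralZl//.
    + by rewrite !integral_normal_pdf mule1 -EFinD ltry.
    + exact: mpdfE.
    + by move=> z _; rewrite lee_fin normal_pdf_ge0.
  - by move=> z _; rewrite lee_fin normal_pdf_ge0.
  - exact: mpdfE.
  - by move=> z _; rewrite -EFinM lee_fin mulr_ge0 ?normal_pdf_ge0.
  - by apply: emeasurable_funM => //; exact: mpdfE.
apply: ge0_le_integral => //.
- by move=> z _; rewrite mule_ge0// lee_fin normal_pdf_ge0.
- apply: emeasurable_funM; last exact: mpdfE.
  by apply/measurable_EFinP; exact: measurableT_comp.
- apply: emeasurable_funD; first exact: mpdfE.
  by apply: emeasurable_funM => //; exact: mpdfE.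
- move=> z _; rewrite /= -!EFinM -EFinD lee_fin ger0_norm//.
  have -> : c * normal_pdf 0 (Num.sqrt 2) z =
      normal_peak 1 * (64 * (expR (- z ^+ 2 / 2) * expR (z ^+ 2 / 4))).
    rewrite (normal_pdfE _ s2) /normal_fun subr0 sqr_sqrtr// -expRD /c.
    have -> : - z ^+ 2 / (2 *+ 2) = - z ^+ 2 / 2 + z ^+ 2 / 4.
      by rewrite mulr2n; field.
    have p2 : normal_peak (Num.sqrt 2) != 0 :> R by rewrite gt_eqF ?normal_peak_gt0.
    by field.
  rewrite normal_pdf01E.
  have -> : `|z| ^+ 3 * (normal_peak 1 * expR (- z ^+ 2 / 2)) =
      normal_peak 1 * (expR (- z ^+ 2 / 2) * `|z| ^+ 3) by ring.
  rewrite -mulrDr ler_wpM2l ?normal_peak_ge0//.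
  have -> : expR (- z ^+ 2 / 2) + 64 * (expR (- z ^+ 2 / 2) * expR (z ^+ 2 / 4)) =
      expR (- z ^+ 2 / 2) * (1 + 64 * expR (z ^+ 2 / 4)) by ring.
  rewrite ler_wpM2l ?expR_ge0//.
  rewrite -lerBlDl; apply: (@le_trans _ _ (z ^+ 4)); last first.
    by have := expR_quarter_ge z; lra.
  have -> : z ^+ 4 = `|z| ^+ 4 by rewrite -normrX ger0_norm// exprn_even_ge0.
  have := normr_ge0 z; set u := `|z| => u0.
  have [u1|u1] := leP u 1.
    rewrite (@le_trans _ _ 0) ?exprn_ge0// subr_le0 exprn_ile1//.
  apply: (@le_trans _ _ (u ^+ 3)); first by rewrite gerBl.
  by rewrite [leRHS]exprS; apply: ler_peMl; [exact: exprn_ge0|exact: ltW].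
Qed.

End moments.
End gaussian.

Section moments.
Context {R : realType}.
Local Notation mu := (@lebesgue_measure R).
Local Notation N := (@normal_prob R 0 1).
Local Notation phi := (@normal_pdf R 0 1).

Lemma ge0_integral_opp (G : R -> R) : continuous G -> (forall x, 0 <= G x) ->
  (\int[mu]_x (G x)%:E = \int[mu]_x (G (- x))%:E)%E.
Proof.
move=> cG G0; have mG : measurable_fun setT G by exact: continuous_measurable_fun.
have cGN : continuous (G \o -%R).
  by move=> x; apply: continuous_comp; [exact: oppr_continuous|exact: cG].
have half (H : R -> R) : continuous H -> (forall x, 0 <= H x) ->
    (\int[mu]_x (H x)%:E =
     \int[mu]_(x in `[0%R, +oo[) (H x)%:E +
     \int[mu]_(x in `[0%R, +oo[) (H (- x))%:E)%E.
  move=> cH H0; have mH : measurable_fun setT H by exact: continuous_measurable_fun.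
  have UE : `]-oo, 0%R] `|` `]0%R, +oo[ = [set: R].
    apply/seteqP; split => // x _ /=; rewrite !in_itv/= andbT.
    by have [] := leP x 0; [left|right].
  rewrite -UE ge0_integral_setU//=.
  - rewrite addeC; congr (_ + _)%E.
      by rewrite integral_itv_obnd_cbnd//; exact/measurable_EFinP/measurable_funTS.
    rewrite -{1}oppr0 ge0_integration_by_substitutionNy ?oppr0//.
    exact: continuous_subspaceT.
  - by apply/measurable_EFinP/measurable_funTS.
  - by move=> x _; rewrite lee_fin.
  - apply/disj_setPS => x [] /=; rewrite !in_itv/= andbT => x0.
    by rewrite ltNge x0.
rewrite half// (half _ cGN)//= addeC; congr (_ + _)%E.
by apply: eq_integral => x _; rewrite opprK.
Qed.

Lemma L1_normal_id : N.-integrable setT (EFin \o (id : R -> R)).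
Proof.
apply: (L1_le _ (L1D (L1_cst N 1) L1_normal_cube)) => //= z.
have := normr_ge0 z; set u := `|z| => u0; have [u1|u1] := leP u 1.
  by rewrite (le_trans u1)// lerDl exprn_ge0.
rewrite (@le_trans _ _ (u ^+ 3)) ?lerDr//.
by rewrite exprS ler_peMr// exprn_ege1// ltW.
Qed.

Lemma L1_normal_sqr : N.-integrable setT (EFin \o (fun z : R => z ^+ 2)).
Proof.
apply: (L1_le _ (L1D (L1_cst N 1) L1_normal_cube)) => [|z /=].
  exact: measurable_funX.
rewrite normrX; have := normr_ge0 z; set u := `|z| => u0; have [u1|u1] := leP u 1.
  by rewrite (@le_trans _ _ 1) ?exprn_ile1// lerDl exprn_ge0.
rewrite (@le_trans _ _ (u ^+ 3)) ?lerDr//.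
by rewrite [leRHS]exprS ler_peMl ?exprn_ge0// ltW.
Qed.

Lemma normal_pdf01N x : phi (- x) = phi x.
Proof. by rewrite !normal_pdf01E sqrrN. Qed.

(** The positive and the negative part of the identity are exchanged by [z
    |-> - z], under which the density is invariant. *)
Lemma mean_normal01 : \int[N]_z z = 0.
Proof.
rewrite /Rintegral integralE.
suff -> : (\int[N]_x (fun z : R => z%:E)^\- x =
           \int[N]_x (fun z : R => z%:E)^\+ x)%E.
  rewrite subee//; apply: integrable_pos_fin_num => //; exact: L1_normal_id.
have pos z : ((fun z : R => z%:E)^\+ z = (Num.max z 0)%:E)%E.
  by rewrite funeposE -EFin_max.
have neg z : ((fun z : R => z%:E)^\- z = (Num.max (- z) 0)%:E)%E.
  by rewrite funenegE -EFin_max.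
under eq_integral do rewrite neg.
under [RHS]eq_integral do rewrite pos.
have cmax : continuous (fun z : R => Num.max z 0).
  by move=> z; apply: continuous_max; [exact: cvg_id|exact: cvg_cst].
have mmax : measurable_fun setT (fun z : R => Num.max z 0).
  exact: continuous_measurable_fun.
rewrite ge0_integral_normal//; last 2 first.
- apply/measurable_EFinP; exact: (measurableT_comp mmax).
- by move=> z; rewrite lee_fin le_max lexx orbT.
rewrite ge0_integral_normal//; last 2 first.
- exact/measurable_EFinP.
- by move=> z; rewrite lee_fin le_max lexx orbT.
under [RHS]eq_integral do rewrite -EFinM.
rewrite [RHS](@ge0_integral_opp (fun z => Num.max z 0 * phi z)).
- by apply: eq_integral => z _; rewrite -EFinM normal_pdf01N.
- by move=> z; apply: cvgM; [exact: cmax|exact: continuous_normal_pdf01].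
- by move=> z; rewrite mulr_ge0 ?normal_pdf_ge0// le_max lexx orbT.
Qed.

Lemma is_derive_normal_pdf (z : R) : is_derive z 1 phi (- z * phi z).
Proof.
rewrite (_ : normal_pdf 0 1 = (fun z => normal_peak 1 * expR (- z ^+ 2 / 2))).
  by apply: is_derive_eq; rewrite !scaler0 add0r /GRing.scale/=; field.
by apply/funext => x; rewrite normal_pdf01E.
Qed.

Lemma is_derive_id_normal_pdf (z : R) :
  is_derive z 1 (fun z : R => z * phi z) ((1 - z ^+ 2) * phi z).
Proof.
have h := is_derive_normal_pdf z.
apply: is_derive_eq; rewrite /GRing.scale/=; ring.
Qed.

Lemma continuous_id_normal_pdf : continuous (fun z : R => z * phi z).
Proof.
move=> z; apply: cvgM; [exact: cvg_id|exact: continuous_normal_pdf01].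
Qed.

Lemma cvg_id_normal_pdf : (fun z : R => z * phi z) @ +oo%R --> (0 : R).
Proof.
apply: (@squeeze_cvgr _ _ _ _ (cst 0) (fun z : R => 2 * normal_peak 1 * z^-1)).
- near=> z; have z0 : 0 < z by near: z; exact: nbhs_pinfty_gt.
  rewrite mulr_ge0 ?normal_pdf_ge0 ?(ltW z0)//= normal_pdf01E.
  have e0 := expR_gt0 (- z ^+ 2 / 2).
  have : z ^+ 2 / 2 * expR (- z ^+ 2 / 2) <= 1.
    rewrite mulNr expRN ler_pdivrMr ?expR_gt0// mul1r.
    by apply: le_trans (expR_ge1Dx _); rewrite lerDr.
  set q := expR _ => hq.
  rewrite ler_pdivlMr//.
  rewrite (_ : _ * _ * z = 2 * normal_peak 1 * (z ^+ 2 / 2 * q)); last by field.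
  by rewrite ler_piMr// mulr_ge0// normal_peak_ge0.
- exact: cvg_cst.
- rewrite -[X in _ --> X](mulr0 (2 * normal_peak 1)).
  apply: cvgMr; apply/gtr0_cvgV0; last exact: cvg_id.
  exact: nbhs_pinfty_gt.
Unshelve. all: by end_near. Qed.

(** The derivative of [z * phi z] is [(1 - z ^+ 2) * phi z]. Its sign
    changes at 1, so the half-line is cut there: on each of the two pieces
    the integrand keeps a constant sign, and the pieces contribute [phi 1]
    each. *)
Lemma integral_normal_unit :
  (\int[mu]_(z in `[0%R, 1%R]) ((1 - z ^+ 2) * phi z)%:E = (phi 1)%:E)%E.
Proof.
have dF z : derivable (fun z : R => z * phi z) z 1 by have [] := is_derive_id_normal_pdf z.
rewrite (@continuous_FTC2 _ _ (fun z : R => z * phi z))//.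
- by rewrite mul1r mul0r sube0.
- apply: continuous_subspaceT => z.
  apply: cvgM; last exact: continuous_normal_pdf01.
  by apply: cvgB; [exact: cvg_cst|exact: exprn_continuous].
- split => //.
  + exact/cvg_at_right_filter/continuous_id_normal_pdf.
  + exact/cvg_at_left_filter/continuous_id_normal_pdf.
- move=> z _; rewrite derive1E.
  exact: (@derive_val _ _ _ _ _ _ _ (is_derive_id_normal_pdf z)).
Qed.

Lemma integral_normal_tail :
  (\int[mu]_(z in `[1%R, +oo[) ((z ^+ 2 - 1) * phi z)%:E = (phi 1)%:E)%E.
Proof.
have dF (z : R) : is_derive z 1 (fun z : R => - (z * phi z)) ((z ^+ 2 - 1) * phi z).
  have h := is_derive_id_normal_pdf z.
  by rewrite -[X in is_derive _ _ _ X]opprK -mulNr opprB; exact: is_deriveN.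
have dF' (z : R) : derivable (fun z : R => - (z * phi z)) z 1 by have [] := dF z.
rewrite (@ge0_continuous_FTC2y _ _ (fun z : R => - (z * phi z)) 1 0)//.
- by rewrite mul1r sub0e EFinN oppeK.
- move=> z z1; rewrite mulr_ge0 ?normal_pdf_ge0// subr_ge0 exprn_ege1//.
- apply: continuous_subspaceT => z.
  apply: cvgM; last exact: continuous_normal_pdf01.
  by apply: cvgB; [exact: exprn_continuous|exact: cvg_cst].
- by rewrite -[X in _ --> X]oppr0; apply: cvgN; exact: cvg_id_normal_pdf.
- by apply: cvgN; exact/cvg_at_right_filter/continuous_id_normal_pdf.
- by move=> z _; rewrite derive1E; exact: (@derive_val _ _ _ _ _ _ _ (dF z)).
Qed.

Lemma integral_normal_half_sqr :
  (\int[mu]_(z in `[0%R, +oo[) (z ^+ 2 * phi z)%:E =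
   \int[mu]_(z in `[0%R, +oo[) (phi z)%:E)%E.
Proof.
have mphi (D : set R) : measurable D -> measurable_fun D (fun z : R => (phi z)%:E).
  move=> mD; apply/measurable_EFinP/measurable_funTS.
  exact: measurable_normal_pdf.
have mM (D : set R) (g : R -> R) : measurable D -> measurable_fun setT g ->
    measurable_fun D (fun z : R => (g z * phi z)%:E).
  move=> mD mg; apply/measurable_EFinP/measurable_funTS.
  apply: measurable_funM => //; exact: measurable_normal_pdf.
have m2 : measurable_fun setT (fun z : R => z ^+ 2) by exact: measurable_funX.
have split_itv (g : R -> R) : (forall z, 0 <= g z) -> measurable_fun setT g ->
    (\int[mu]_(z in `[0%R, +oo[) (g z)%:E =
     \int[mu]_(z in `[0%R, 1%R]) (g z)%:E + \int[mu]_(z in `[1%R, +oo[) (g z)%:E)%E.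
  move=> g0 mg; rewrite (@itv_bndbnd_setU _ _ _ (BRight 1))//.
  2: by rewrite bnd_simp.
  rewrite ge0_integral_setU//=.
  - congr (_ + _)%E; rewrite integral_itv_obnd_cbnd//.
    exact/measurable_EFinP/measurable_funTS.
  - by apply/measurable_EFinP/measurable_funTS.
  - by move=> z _; rewrite lee_fin.
  - apply/disj_setPS => x [] /=; rewrite !in_itv/= andbT => /andP[_ x1].
    by rewrite ltNge x1.
rewrite [RHS]split_itv; last 2 first.
- exact: normal_pdf_ge0.
- exact: measurable_normal_pdf.
rewrite [LHS]split_itv; last 2 first.
- by move=> z; rewrite mulr_ge0 ?sqr_ge0 ?normal_pdf_ge0.
- by apply: measurable_funM => //; exact: measurable_normal_pdf.
have -> : (\int[mu]_(z in `[0%R, 1%R]) (phi z)%:E =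
    \int[mu]_(z in `[0%R, 1%R]) (z ^+ 2 * phi z)%:E + (phi 1)%:E)%E.
  rewrite -integral_normal_unit -ge0_integralD//.
  - by apply: eq_integral => z _; rewrite -EFinD; congr _%:E; ring.
  - by move=> z _; rewrite lee_fin mulr_ge0 ?sqr_ge0 ?normal_pdf_ge0.
  - exact: mM.
  - move=> z /=; rewrite in_itv/= => /andP[z0 z1].
    by rewrite lee_fin mulr_ge0 ?normal_pdf_ge0// subr_ge0 expr_le1.
  - by apply: mM => //; exact: measurable_funB.
have -> : (\int[mu]_(z in `[1%R, +oo[) (z ^+ 2 * phi z)%:E =
    \int[mu]_(z in `[1%R, +oo[) (phi z)%:E + (phi 1)%:E)%E.
  rewrite -integral_normal_tail -ge0_integralD//.
  - by apply: eq_integral => z _; rewrite -EFinD; congr _%:E; ring.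
  - by move=> z _; rewrite lee_fin normal_pdf_ge0.
  - exact: mphi.
  - move=> z /=; rewrite in_itv/= andbT => z1.
    by rewrite lee_fin mulr_ge0 ?normal_pdf_ge0// subr_ge0 exprn_ege1.
  - by apply: mM => //; exact: measurable_funB.
by rewrite addeA addeAC.
Qed.

(** By [integral_normal_half_sqr] and parity, the second moment is the total
    mass of the density. *)
Lemma second_moment_normal01 : \int[N]_z z ^+ 2 = 1.
Proof.
have ge0T : [set z : R | 0 <= z] = `[0, +oo[%classic.
  by apply/seteqP; split => x /=; rewrite in_itv/= andbT.
rewrite /Rintegral ge0_integral_normal//; last 2 first.
- exact/measurable_EFinP/measurable_funX.
- by move=> z; rewrite lee_fin sqr_ge0.
under eq_integral do rewrite -EFinM.
rewrite ge0_symfun_integralT//; last 3 first.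
- by move=> z; rewrite mulr_ge0 ?sqr_ge0 ?normal_pdf_ge0.
- by move=> z; apply: cvgM; [exact: exprn_continuous|exact: continuous_normal_pdf01].
- by move=> z /=; rewrite sqrrN normal_pdf01N.
rewrite ge0T integral_normal_half_sqr -ge0T -ge0_symfun_integralT.
- by rewrite integral_normal_pdf.
- exact: normal_pdf_ge0.
- exact: continuous_normal_pdf01.
- by move=> z /=; rewrite normal_pdf01N.
Qed.

End moments.

(** * Averages of translates *)

Definition mean_shift {R : realType} {d} {T : measurableType d}
    (P : probability T R) (X : T -> R) (u : R -> R) (y : R) : R :=
  \int[P]_t u (y + X t).

(** Here [u1] and [u2] stand for the first two derivatives of [u]. No
    differentiability is required: only bounds on this remainder are used,
    and for splines they are algebraic. *)
Definition taylor_rem {R : realType} (u u1 u2 : R -> R) (x h : R) : R :=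
  u (x + h) - u x - h * u1 x - h ^+ 2 / 2 * u2 x.

Section mean_shift.
Context {R : realType} {d : measure_display} {T : measurableType d}.
Variables (P : probability T R) (X : T -> R).
Hypothesis mX : measurable_fun setT X.

Local Notation L1 f := (P.-integrable setT (EFin \o f)).

Lemma measurable_shift (u : R -> R) (y : R) : measurable_fun setT u ->
  measurable_fun setT (fun t => u (y + X t)).
Proof. by move=> mu; apply: measurableT_comp => //; exact: measurable_funD. Qed.

Lemma L1_shift (u : R -> R) (K y : R) : measurable_fun setT u ->
  (forall x, `|u x| <= K) -> L1 (fun t => u (y + X t)).
Proof.
by move=> mu uK; apply: (@L1_bounded _ _ _ _ _ K) => //; exact: measurable_shift.
Qed.

Lemma mean_shiftE (u : R -> R) (K y : R) : measurable_fun setT u ->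
  (forall x, `|u x| <= K) ->
  ((mean_shift P X u y)%:E = \int[P]_t (u (y + X t))%:E)%E.
Proof.
by move=> mu uK; rewrite fineK//; apply: integrable_fin_num => //; exact: L1_shift.
Qed.

Lemma mean_shift_bounded (u : R -> R) (K y : R) : measurable_fun setT u ->
  (forall x, `|u x| <= K) -> `|mean_shift P X u y| <= K.
Proof.
move=> mu uK; have Lu := L1_shift y mu uK.
rewrite (le_trans (le_normr_Rintegral _ _))// -[leRHS](Rintegral_prob_cst P).
apply: le_Rintegral => //; [exact: integrable_norm|exact: L1_cst].
Qed.

Lemma mean_shift_ge0 (u : R -> R) (y : R) : (forall x, 0 <= u x) ->
  0 <= mean_shift P X u y.
Proof. by move=> u0; exact: Rintegral_ge0. Qed.

Lemma measurable_mean_shift (u : R -> R) : measurable_fun setT u ->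
  (forall x, 0 <= u x) -> measurable_fun setT (mean_shift P X u).
Proof.
move=> mu u0; apply: measurableT_comp => //.
pose h : R * T -> \bar R := EFin \o (fun yt => u (yt.1 + X yt.2)).
apply: (@measurable_fun_fubini_tonelli_F _ _ _ _ _ P h).
  apply/measurable_EFinP/measurableT_comp => //.
  by apply: measurable_funD => //; exact: measurableT_comp.
by move=> x; rewrite lee_fin.
Qed.

Lemma mean_shift_taylor (u u1 u2 : R -> R) (K x h b : R) :
  measurable_fun setT u -> measurable_fun setT u1 -> measurable_fun setT u2 ->
  (forall x, `|u x| <= K) -> (forall x, `|u1 x| <= K) -> (forall x, `|u2 x| <= K) ->
  (forall y, `|taylor_rem u u1 u2 y h| <= b) ->
  `|taylor_rem (mean_shift P X u) (mean_shift P X u1) (mean_shift P X u2) x h| <= b.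
Proof.
move=> mu mu1 mu2 uK u1K u2K ub.
have -> : taylor_rem (mean_shift P X u) (mean_shift P X u1) (mean_shift P X u2) x h
    = mean_shift P X (fun y => taylor_rem u u1 u2 y h) x.
  rewrite /taylor_rem /mean_shift.
  have Lu y := L1_shift y mu uK.
  have Lu1 := L1_shift x mu1 u1K; have Lu2 := L1_shift x mu2 u2K.
  transitivity (\int[P]_t (u (x + h + X t) - u (x + X t) -
    h * u1 (x + X t) - h ^+ 2 / 2 * u2 (x + X t))); last first.
    by apply: eq_Rintegral => t _ /=; rewrite [x + h + _]addrAC.
  rewrite RintegralB//; [|by apply: L1B; [exact: L1B|exact: L1Z]|exact: L1Z].
  rewrite RintegralB//; [|exact: L1B|exact: L1Z].
  by rewrite RintegralB// !RintegralZl.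
apply: mean_shift_bounded => //.
rewrite /taylor_rem; apply: measurable_funB; last exact: measurable_funM.
apply: measurable_funB; last exact: measurable_funM.
apply: measurable_funB => //; apply: measurableT_comp => //.
exact: measurable_funD.
Qed.

(** The term of order one in the expansion vanishes with the mean of [X],
    and the term of order two only sees the variance of [X]. *)
Lemma mean_shift_second_order (u u1 u2 : R -> R) (K x : R) (g : T -> R) :
  measurable_fun setT u -> (forall x, `|u x| <= K) ->
  \int[P]_t X t = 0 -> L1 (fun t => X t ^+ 2) -> L1 g ->
  (forall t, `|taylor_rem u u1 u2 x (X t)| <= g t) ->
  `|mean_shift P X u x - (u x + (\int[P]_t X t ^+ 2) / 2 * u2 x)| <= \int[P]_t g t.
Proof.
move=> mu uK EX LX2 Lg ug; have LX := L1_of_sqr mX LX2.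
have Lu := L1_shift x mu uK.
pose a t := u x + X t * u1 x + X t ^+ 2 * (u2 x / 2).
have LXu : L1 (fun t => X t * u1 x).
  by have := L1Z (u1 x) LX; apply: eq_integrable => // t _ /=; rewrite mulrC.
have LX2u : L1 (fun t => X t ^+ 2 * (u2 x / 2)).
  by have := L1Z (u2 x / 2) LX2; apply: eq_integrable => // t _ /=; rewrite mulrC.
have La : L1 a by apply: L1D => //; apply: L1D => //; exact: L1_cst.
have -> : u x + (\int[P]_t X t ^+ 2) / 2 * u2 x = \int[P]_t a t.
  rewrite RintegralD//; last by apply: L1D => //; exact: L1_cst.
  rewrite RintegralD//; last exact: L1_cst.
  rewrite !RintegralZr// EX mul0r addr0 (Rintegral_prob_cst P (u x)).
  by congr (_ + _); field.
rewrite /mean_shift -RintegralB// (le_trans (le_normr_Rintegral _ _))//; last first.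
  apply: le_Rintegral => //; first exact/integrable_norm/L1B.
  move=> t _; apply: le_trans (ug t); rewrite le_eqVlt; apply/orP; left; apply/eqP.
  by rewrite /taylor_rem /a; congr `|_|; field.
exact: L1B.
Qed.

End mean_shift.

(** * Lindeberg's replacement of the summands by Gaussians *)

Section gauss_op.
Context {R : realType}.
Local Notation N := (@normal_prob R 0 1).

Definition gauss_op (s : R) (u : R -> R) : R -> R :=
  mean_shift N (fun z => s * z) u.

Lemma measurable_scale (s : R) : measurable_fun setT (fun z : R => s * z).
Proof. exact: measurable_funM. Qed.

Lemma gauss_op0 (u : R -> R) y : gauss_op 0 u y = u y.
Proof.
rewrite /gauss_op /mean_shift -[RHS](Rintegral_prob_cst N).
by apply: eq_Rintegral => t _ /=; rewrite mul0r addr0.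
Qed.

(** The variances [s ^+ 2] and [t ^+ 2] add up, by [normal_convolution]. The
    case [t = 0] is apart because that lemma divides by [t]. *)
Lemma gauss_op_semigroup (s t r K : R) (u : R -> R) (x : R) :
  0 <= s -> 0 <= t -> 0 <= r -> r ^+ 2 = s ^+ 2 + t ^+ 2 ->
  continuous u -> (forall x, 0 <= u x) -> (forall x, `|u x| <= K) ->
  gauss_op s (gauss_op t u) x = gauss_op r u x.
Proof.
move=> s0 t0 r0 rst cu u0 uK.
have mu : measurable_fun setT u by exact: continuous_measurable_fun.
have [t_eq0|t_neq0] := eqVneq t 0.
  have -> : r = s by apply/eqP; rewrite -(eqrXn2 (n := 2))// rst t_eq0 expr0n addr0.
  by rewrite t_eq0; congr (gauss_op s _ x); apply/funext => y; rewrite gauss_op0.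
have tp : 0 < t by rewrite lt0r t_neq0.
have rp : 0 < r.
  rewrite lt0r r0 andbT -sqrf_eq0 rst gt_eqF//.
  by rewrite ltr_wpDl ?sqr_ge0// exprn_gt0.
have mG : measurable_fun setT (gauss_op t u).
  by apply: measurable_mean_shift => //; exact: measurable_scale.
have GK y : `|gauss_op t u y| <= K.
  exact: (mean_shift_bounded N (measurable_scale t) y mu uK).
apply: EFin_inj.
rewrite (mean_shiftE N (measurable_scale s) x mG GK).
rewrite (mean_shiftE N (measurable_scale r) x mu uK).
have cux : continuous (fun y => u (x + y)).
  move=> y; apply: continuous_comp; last exact: cu.
  by apply: cvgD; [exact: cvg_cst|exact: cvg_id].
rewrite -(normal_convolution (f := fun y => u (x + y)) tp rp rst)//.
apply: eq_integral => z _; rewrite (mean_shiftE N (measurable_scale t) _ mu uK).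
by apply: eq_integral => w _; rewrite addrA.
Qed.

End gauss_op.

Section lindeberg_swap.
Context {R : realType} {d : measure_display} {T : measurableType d}.
Variable P : probability T R.
Context {I : finType} (X : I -> {RV P >-> R}).
Hypothesis indX : mutually_independent X.
Hypothesis sqrX : forall i, P.-integrable setT (EFin \o (fun t => X i t ^+ 2)).
Hypothesis meanX : forall i, \int[P]_t X i t = 0.
Hypothesis var1 : \sum_i \int[P]_t X i t ^+ 2 = 1.

Variables (f f1 f2 : R -> R) (K M e : R).
Hypotheses (cf : continuous f) (f0 : forall x, 0 <= f x).
Hypothesis fK : forall x, `|f x| <= K.
Hypotheses (mf1 : measurable_fun setT f1) (f1K : forall x, `|f1 x| <= K).
Hypotheses (mf2 : measurable_fun setT f2) (f2K : forall x, `|f2 x| <= K).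
Hypothesis taylor2 : forall x h, `|taylor_rem f f1 f2 x h| <= M * h ^+ 2.
Hypothesis taylor3 : forall x h, `|taylor_rem f f1 f2 x h| <= M * `|h| ^+ 3.
Hypotheses (M0 : 0 <= M) (e0 : 0 < e).

Local Notation N := (@normal_prob R 0 1).
Local Notation L1 f := (P.-integrable setT (EFin \o f)).

Definition abs_moment3 : R := \int[N]_z `|z| ^+ 3.

Let sigma2 i : R := \int[P]_t X i t ^+ 2.
Let sigma i : R := Num.sqrt (sigma2 i).

Definition sqr_tail i : R := \int[P]_t (X i t ^+ 2 * \1_(exceed e) (X i t)).

(** The cost of exchanging [X i] for a Gaussian of the same variance: the
    first part comes from [X i], cut at [e], the second from the Gaussian. *)
Definition swap_error i : R :=
  M * (e * sigma2 i + sqr_tail i) + M * abs_moment3 * sigma i ^+ 3.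

Let mf : measurable_fun setT f. Proof. exact: continuous_measurable_fun. Qed.

Let sigma2_ge0 i : 0 <= sigma2 i.
Proof. by apply: Rintegral_ge0 => t _; exact: sqr_ge0. Qed.

Let m1A : measurable_fun setT (\1_(exceed e) : R -> R).
Proof. by apply: measurable_indic; exact: measurable_exceed. Qed.

Let L1tail i : L1 (fun t => X i t ^+ 2 * \1_(exceed e) (X i t)).
Proof.
apply: (L1_mulbnd _ _ (sqrX i)) => [|t]; first exact: measurableT_comp.
by rewrite indicE; case: (_ \in _); rewrite ?normr1 ?normr0 ?ler01.
Qed.

(** Both averages are compared with the same expansion [u y + sigma2 i / 2 *
    u2 y]. For [X i], the remainder is bounded by the cube below the level
    [e] and by the square above it; for the Gaussian, by the cube
    throughout. *)
Lemma lindeberg_step i (r y : R) :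
  `|mean_shift P (X i) (gauss_op r f) y - gauss_op (sigma i) (gauss_op r f) y|
  <= swap_error i.
Proof.
set u := gauss_op r f; pose u1 := gauss_op r f1; pose u2 := gauss_op r f2.
have mu : measurable_fun setT u.
  by apply: measurable_mean_shift => //; exact: measurable_scale.
have uK x : `|u x| <= K.
  exact: (mean_shift_bounded N (measurable_scale r) x mf fK).
have u_taylor2 x h : `|taylor_rem u u1 u2 x h| <= M * h ^+ 2.
  by apply: (mean_shift_taylor N (measurable_scale r) x mf mf1 mf2 fK f1K f2K).
have u_taylor3 x h : `|taylor_rem u u1 u2 x h| <= M * `|h| ^+ 3.
  by apply: (mean_shift_taylor N (measurable_scale r) x mf mf1 mf2 fK f1K f2K).
pose c := u y + sigma2 i / 2 * u2 y.
pose g t := M * (e * X i t ^+ 2 + X i t ^+ 2 * \1_(exceed e) (X i t)).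
pose gz (z : R) : R := M * sigma i ^+ 3 * `|z| ^+ 3.
have Lg : L1 g by apply: L1Z; apply: L1D => //; exact: L1Z.
have bX : `|mean_shift P (X i) u y - c| <= M * (e * sigma2 i + sqr_tail i).
  have -> : M * (e * sigma2 i + sqr_tail i) = \int[P]_t g t.
    rewrite RintegralZl//; last by apply: L1D => //; exact: L1Z.
    by rewrite RintegralD//; [rewrite RintegralZl|exact: L1Z].
  apply: (mean_shift_second_order _ mu uK) => // t.
  rewrite /g indicE; have [_|/negP tA] := boolP (X i t \in exceed e).
    apply: le_trans (u_taylor2 _ _) _; rewrite ler_wpM2l// mulr1 lerDr.
    by rewrite mulr_ge0 ?sqr_ge0// ltW.
  rewrite mulr0 addr0; apply: le_trans (u_taylor3 _ _) _.
  rewrite ler_wpM2l// exprS real_normK ?num_real// ler_wpM2r ?sqr_ge0//.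
  by rewrite leNgt; apply/negP => ?; apply: tA; apply/mem_set.
have bZ : `|gauss_op (sigma i) u y - c| <= M * abs_moment3 * sigma i ^+ 3.
  have Lz2 := L1Z (sigma i ^+ 2) (@L1_normal_sqr R).
  have EZ2 : \int[N]_z (sigma i * z) ^+ 2 = sigma2 i.
    under eq_Rintegral do rewrite exprMn.
    rewrite RintegralZl ?second_moment_normal01 ?mulr1 ?sqr_sqrtr//.
    exact: L1_normal_sqr.
  have -> : M * abs_moment3 * sigma i ^+ 3 = \int[N]_z gz z.
    by rewrite RintegralZl//; [rewrite mulrAC|exact: L1_normal_cube].
  rewrite /c -EZ2; apply: (mean_shift_second_order _ mu uK) => //.
  - exact: measurable_scale.
  - by rewrite RintegralZl ?mean_normal01 ?mulr0//; exact: L1_normal_id.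
  - by apply: eq_integrable Lz2 => // z _ /=; rewrite exprMn.
  - by apply: L1Z; exact: L1_normal_cube.
  - move=> z; apply: le_trans (u_taylor3 _ _) _.
    by rewrite /gz normrM exprMn mulrA ger0_norm ?sqrtr_ge0.
rewrite -(subrKA c) (le_trans (ler_normD _ _))// /swap_error lerD//.
by rewrite distrC.
Qed.

Let S J := partial_sum X J.
(** The standard deviation of the Gaussian that stands for the entries
    outside [J]. *)
Let rest (J : {set I}) : R := Num.sqrt (1 - \sum_(j in J) sigma2 j).

Let rest_sqr (J : {set I}) : rest J ^+ 2 = 1 - \sum_(j in J) sigma2 j.
Proof.
rewrite sqr_sqrtr// subr_ge0 -var1 [leRHS](bigID (mem J))/= lerDl.
by apply: sumr_ge0 => j _; exact: sigma2_ge0.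
Qed.

Let measurable_gauss_f r : measurable_fun setT (gauss_op r f).
Proof. by apply: measurable_mean_shift => //; exact: measurable_scale. Qed.

Let gauss_f_ge0 r y : 0 <= gauss_op r f y.
Proof. exact: mean_shift_ge0. Qed.

Let gauss_f_bounded r y : `|gauss_op r f y| <= K.
Proof. exact: (mean_shift_bounded N (measurable_scale r) y mf fK). Qed.

Let L1_comp_S (u : R -> R) J : measurable_fun setT u -> (forall x, `|u x| <= K) ->
  L1 (fun t => u (S J t)).
Proof.
move=> mu uK; apply: (@L1_bounded _ _ _ _ _ K) => //.
by apply: measurableT_comp => //; exact: measurable_partial_sum.
Qed.

Let split_last (J : {set I}) i (u : R -> R) : i \notin J ->
  measurable_fun setT u -> (forall x, 0 <= u x) -> (forall x, `|u x| <= K) ->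
  \int[P]_t u (S (i |: J) t) = \int[P]_t mean_shift P (X i) u (S J t).
Proof.
move=> iJ mu u0 uK; rewrite /Rintegral; congr fine.
pose h : R * R -> \bar R := EFin \o (fun yx => u (yx.1 + yx.2)).
have mh : measurable_fun setT h.
  by apply/measurable_EFinP/measurableT_comp => //; exact: measurable_funD.
have mS := measurable_partial_sum sqrX J.
pose S' : {mfun T >-> R} := HB.pack (S J) (isMeasurableFun.Build _ _ _ _ _ mS).
have ind := indep_partial_sum indX iJ.
transitivity (\int[P]_t h (S' t, X i t))%E.
  by apply: eq_integral => t _; rewrite /h /= /S partial_sum_setU1.
rewrite indep_pair_fubini_tonelli//; last by move=> z; rewrite lee_fin.
by apply: eq_integral => t _; rewrite (mean_shiftE P _ _ mu uK).
Qed.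

(** Adding [i] to [J] replaces a Gaussian piece of variance [sigma2 i] by [X
    i]. By the semigroup property, [gauss_op (rest J) f = gauss_op (sigma i)
    (gauss_op (rest (i |: J)) f)], so [lindeberg_step] applies to the
    function [gauss_op (rest (i |: J)) f] at the point [S J t], which is
    independent of [X i]. *)
Lemma lindeberg_telescope (J : {set I}) :
  `|\int[P]_t gauss_op (rest J) f (S J t) - gauss_op 1 f 0|
  <= \sum_(j in J) swap_error j.
Proof.
move: J; apply: finset_ind => [|J i iJ IH].
  rewrite big_set0 /rest big_set0 subr0 sqrtr1.
  rewrite (_ : \int[P]_t _ = gauss_op 1 f 0) ?subrr ?normr0//.
  rewrite -[RHS](Rintegral_prob_cst P); apply: eq_Rintegral => t _.
  by rewrite /S partial_sum0.
rewrite big_setU1//=.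
set u := gauss_op (rest (i |: J)) f.
have mu : measurable_fun setT u by exact: measurable_gauss_f.
have uK x : `|u x| <= K by exact: gauss_f_bounded.
have u0 x : 0 <= u x by exact: gauss_f_ge0.
rewrite split_last//.
rewrite -(subrKA (\int[P]_t gauss_op (rest J) f (S J t))).
rewrite (le_trans (ler_normD _ _))// lerD//.
have mXi : measurable_fun setT (X i) by [].
have mm : measurable_fun setT (mean_shift P (X i) u) by exact: measurable_mean_shift.
have mK x : `|mean_shift P (X i) u x| <= K.
  exact: (mean_shift_bounded P mXi x mu uK).
rewrite -RintegralB//; [|exact: L1_comp_S|exact: L1_comp_S].
rewrite (le_trans (le_normr_Rintegral _ _))//.
  by apply: L1B; exact: L1_comp_S.
rewrite -[leRHS](Rintegral_prob_cst P); apply: le_Rintegral => //.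
- by apply: integrable_norm; apply: L1B; exact: L1_comp_S.
- exact: L1_cst.
- move=> t _ /=.
  rewrite -(@gauss_op_semigroup _ (sigma i) (rest (i |: J)) (rest J) K f (S J t))//.
  + exact: lindeberg_step.
  + exact: sqrtr_ge0.
  + exact: sqrtr_ge0.
  + exact: sqrtr_ge0.
  + by rewrite !rest_sqr sqr_sqrtr// big_setU1//=; ring.
Qed.

Lemma sqr_tail_ge0 i : 0 <= sqr_tail i.
Proof.
by apply: Rintegral_ge0 => t _; rewrite indicE mulr_ge0 ?sqr_ge0.
Qed.

(** The bound on the tails also makes every variance small: [sigma2 i <= e
    ^+ 2 + sqr_tail i <= 2 * e ^+ 2], whence [sigma i <= 2 * e] and [sigma i
    ^+ 3 <= 2 * e * sigma2 i]. *)
Lemma lindeberg_bound : e <= 1 -> \sum_i sqr_tail i <= e ^+ 2 ->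
  `|\int[P]_t f (partial_sum X finset.setT t) - gauss_op 1 f 0| <=
  M * (2 + 2 * abs_moment3) * e.
Proof.
move=> e1 tail_le.
have kappa0 : 0 <= abs_moment3 by apply: Rintegral_ge0 => z _; exact: exprn_ge0.
have sigma_le i : sigma i <= 2 * e.
  rewrite -(ler_sqr (_ : sigma i \in Num.nneg) (_ : 2 * e \in Num.nneg))
    ?nnegrE ?sqrtr_ge0 ?mulr_ge0 ?(ltW e0)//.
  rewrite sqr_sqrtr//.
  have tail_i : sqr_tail i <= e ^+ 2.
    apply: le_trans tail_le; rewrite (bigD1 i)//= lerDl.
    by apply: sumr_ge0 => j _; exact: sqr_tail_ge0.
  suff : sigma2 i <= e ^+ 2 + sqr_tail i by move=> h; have := sqr_ge0 e; nra.
  rewrite -[X in X + _](Rintegral_prob_cst P) -RintegralD//; last exact: L1_cst.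
  apply: le_Rintegral => //; first by apply: L1D => //; exact: L1_cst.
  move=> t _ /=; rewrite indicE; have [_|/negP tA] := boolP (X i t \in exceed e).
    by rewrite mulr1 lerDr sqr_ge0.
  rewrite mulr0 addr0 -(real_normK (num_real (X i t))) lerXn2r ?nnegrE ?(ltW e0)//.
  by rewrite leNgt; apply/negP => ?; apply: tA; apply/mem_set.
have := lindeberg_telescope finset.setT.
rewrite /rest (eq_bigl xpredT); last by move=> j; rewrite inE.
rewrite var1 subrr sqrtr0.
under eq_Rintegral do rewrite gauss_op0.
move=> /le_trans; apply.
apply: (@le_trans _ _ (\sum_i (M * e * sigma2 i + M * sqr_tail i +
    M * abs_moment3 * (2 * e) * sigma2 i))).
  rewrite (eq_bigl xpredT); last by move=> j; rewrite inE.
  apply: ler_sum => i _; rewrite /swap_error.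
  have cube_le : sigma i ^+ 3 <= 2 * e * sigma2 i.
    by rewrite exprS [sigma i ^+ 2]sqr_sqrtr// ler_wpM2r.
  have := ler_wpM2l (mulr_ge0 M0 kappa0) cube_le; lra.
rewrite !big_split /= -!mulr_sumr var1 !mulr1.
have : M * \sum_i sqr_tail i <= M * e.
  rewrite ler_wpM2l// (le_trans tail_le)// expr2 ler_piMl// ltW//.
set q := M * \sum_i _ => hq; lra.
Qed.

End lindeberg_swap.

(** * Smooth approximations of a half-line *)

Section smooth_step.
Context {R : realType}.
Implicit Types x h : R.

Let pos x : R := Num.max x 0.

Let pos_ge0E x : 0 <= x -> pos x = x.
Proof. by move=> x0; rewrite /pos; case: ltrgtP x0. Qed.

Let pos_le0E x : x <= 0 -> pos x = 0.
Proof. by move=> x0; rewrite /pos; case: ltrgtP x0. Qed.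

(** The third backward difference. Applied to truncated powers it produces
    B-splines: [smooth_step] is the integral of the quadratic B-spline with
    knots 0, 1, 2, 3, and rises from 0 to 1 between 0 and 3; [smooth_step1]
    and [smooth_step2] are its first two derivatives. *)
Definition third_difference (g : R -> R) x : R :=
  g x - 3 * g (x - 1) + 3 * g (x - 2) - g (x - 3).

Definition smooth_step x : R := third_difference (fun y => Num.max y 0 ^+ 3) x / 6.
Definition smooth_step1 x : R := third_difference (fun y => Num.max y 0 ^+ 2) x / 2.
Definition smooth_step2 x : R := third_difference (fun y => Num.max y 0) x.

(** When [x] and [x + h] have the same sign the remainder is [h ^+ 3] or 0;
    otherwise 0 lies between them, and [|x|] and [|x + h|] are at most
    [|h|]. *)
Lemma truncated_cube_taylor x h :
  `|pos (x + h) ^+ 3 - pos x ^+ 3 - 3 * h * pos x ^+ 2 - 3 * h ^+ 2 * pos x|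
  <= `|h| ^+ 3.
Proof.
have [x0|x0] := leP 0 x; have [xh0|xh0] := leP 0 (x + h).
- rewrite !pos_ge0E// -normrX le_eqVlt; apply/orP; left; apply/eqP.
  by congr `|_|; ring.
- rewrite (pos_ge0E x0) (pos_le0E (ltW xh0)) -normrX.
  have h0 : h < 0 by lra.
  rewrite [X in _ <= X]ler0_norm; last by rewrite exprn_odd_le0// ltW.
  have y3 : (x + h) ^+ 3 <= 0 by rewrite exprn_odd_le0// ltW.
  have h3 : h ^+ 3 <= 0 by rewrite exprn_odd_le0// ltW.
  have hy : h ^+ 3 <= (x + h) ^+ 3.
    rewrite -subr_ge0.
    rewrite (_ : _ - _ = x * (x ^+ 2 + 3 * x * h + 3 * h ^+ 2)); last by ring.
    by rewrite mulr_ge0//; have := sqr_ge0 (2 * x + 3 * h); have := sqr_ge0 h; nra.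
  move: y3 hy; rewrite (_ : (x + h) ^+ 3 =
    h ^+ 3 + 3 * h * x ^+ 2 + 3 * h ^+ 2 * x + x ^+ 3); last by ring.
  by rewrite expr0n /= ler_norml => *; apply/andP; split; lra.
- rewrite (pos_le0E (ltW x0)) (pos_ge0E xh0) -normrX.
  have h0 : 0 < h by lra.
  rewrite !ger0_norm ?exprn_ge0 ?(ltW h0)//; last first.
    by rewrite !(expr0n, mulr0, subr0) exprn_ge0.
  by rewrite !(expr0n, mulr0, subr0) lerXn2r ?nnegrE// ?(ltW h0)//; lra.
- rewrite (pos_le0E (ltW x0)) (pos_le0E (ltW xh0)) !(expr0n, mulr0, subr0)/=.
  by rewrite normr0 exprn_ge0.
Qed.

Lemma smooth_step_taylor3 x h :
  `|taylor_rem smooth_step smooth_step1 smooth_step2 x h| <= 3 * `|h| ^+ 3.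
Proof.
pose D y := pos (y + h) ^+ 3 - pos y ^+ 3 - 3 * h * pos y ^+ 2 - 3 * h ^+ 2 * pos y.
have -> : taylor_rem smooth_step smooth_step1 smooth_step2 x h =
    third_difference D x / 6.
  rewrite /taylor_rem /smooth_step /smooth_step1 /smooth_step2 /third_difference /D.
  rewrite ![x + h - _]addrAC -/(pos _) -!/(pos _); by field.
have Dx y := truncated_cube_taylor y h.
have D0 := Dx x; have D1 := Dx (x - 1); have D2 := Dx (x - 2); have D3 := Dx (x - 3).
rewrite /third_difference.
move: D0 D1 D2 D3; rewrite -!/(D _).
set a0 := D x; set a1 := D (x - 1); set a2 := D (x - 2); set a3 := D (x - 3).
have := exprn_ge0 3 (normr_ge0 h); set H := `|h| ^+ 3 => H0.
rewrite !ler_norml => /andP[? ?] /andP[? ?] /andP[? ?] /andP[? ?].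
by apply/andP; split; lra.
Qed.

Lemma smooth_step_bounds x :
  [/\ 0 <= smooth_step x <= 1, `|smooth_step1 x| <= 1 & `|smooth_step2 x| <= 1].
Proof.
rewrite /smooth_step /smooth_step1 /smooth_step2 /third_difference -!/(pos _).
have [x0|x0] := leP x 0.
  rewrite !pos_le0E; [|lra..].
  by rewrite !(expr0n, mulr0, subr0, addr0, mul0r) normr0 ler01 lexx.
have [x1|x1] := leP x 1.
  rewrite (pos_ge0E (ltW x0)) !pos_le0E; [|lra..].
  rewrite !(expr0n, mulr0, subr0, addr0, mul0r) /= !ler_norml.
  by split; [apply/andP; split..]; nra.
have [x2|x2] := leP x 2.
  rewrite (pos_ge0E (ltW x0)) (@pos_ge0E (x - 1)) ?(@pos_le0E (x - 2))
    ?(@pos_le0E (x - 3)); [|lra..].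
  rewrite !(expr0n, mulr0, subr0, addr0, mul0r) /= !ler_norml.
  have [u ux] : exists u, x = 1 + u by exists (x - 1); ring.
  rewrite ux in x1 x2 *; rewrite addrAC subrr add0r.
  by split; [apply/andP; split..]; nra.
have [x3|x3] := leP x 3.
  rewrite (pos_ge0E (ltW x0)) (@pos_ge0E (x - 1)) ?(@pos_ge0E (x - 2))
    ?(@pos_le0E (x - 3)); [|lra..].
  rewrite !(expr0n, mulr0, subr0, addr0, mul0r) /= !ler_norml.
  have [u ux] : exists u, x = 3 - u by exists (3 - x); ring.
  rewrite ux in x2 x3 *.
  by split; [apply/andP; split..]; nra.
rewrite !pos_ge0E; [|lra..].
have -> : (x ^+ 3 - 3 * (x - 1) ^+ 3 + 3 * (x - 2) ^+ 3 -
    (x - 3) ^+ 3) / 6 = 1 by field.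
have -> : (x ^+ 2 - 3 * (x - 1) ^+ 2 + 3 * (x - 2) ^+ 2 -
    (x - 3) ^+ 2) / 2 = 0 by field.
have -> : x - 3 * (x - 1) + 3 * (x - 2) - (x - 3) = 0 by ring.
by rewrite normr0 ler01 lexx.
Qed.

Lemma smooth_step_le0 x : x <= 0 -> smooth_step x = 0.
Proof.
move=> x0; rewrite /smooth_step /third_difference -!/(pos _) !pos_le0E; [|lra..].
by rewrite !(expr0n, mulr0, subr0, addr0, mul0r).
Qed.

Lemma smooth_step_ge3 x : 3 <= x -> smooth_step x = 1.
Proof.
move=> x3; rewrite /smooth_step /third_difference -!/(pos _) !pos_ge0E; [|lra..].
by field.
Qed.

(** For [|h| <= 1] the cubic bound is better; for larger [h] the bounds on
    the function and its derivatives suffice. *)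
Lemma smooth_step_taylor2 x h :
  `|taylor_rem smooth_step smooth_step1 smooth_step2 x h| <= 3 * h ^+ 2.
Proof.
rewrite -(real_normK (num_real h)).
have [h1|h1] := leP `|h| 1.
  apply: le_trans (smooth_step_taylor3 x h) _.
  by rewrite ler_wpM2l// exprS ler_piMl// exprn_ge0.
have [/andP[a0 a1] b1 c1] := smooth_step_bounds x.
have [/andP[d0 d1] _ _] := smooth_step_bounds (x + h).
rewrite /taylor_rem.
have hb : `|h * smooth_step1 x| <= `|h| ^+ 2.
  by rewrite normrM expr2 ler_wpM2l// (le_trans b1)// ltW.
have hc : `|h ^+ 2 / 2 * smooth_step2 x| <= `|h| ^+ 2.
  rewrite normrM ger0_norm ?divr_ge0 ?sqr_ge0// real_normK ?num_real//.
  have := sqr_ge0 h; have := normr_ge0 (smooth_step2 x); nra.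
have hH : 1 <= `|h| ^+ 2 by rewrite exprn_ege1// ltW.
move: hb hc hH; set H := `|h| ^+ 2; rewrite !ler_norml => /andP[? ?] /andP[? ?] ?.
by apply/andP; split; lra.
Qed.

Lemma continuous_third_difference (g : R -> R) :
  continuous g -> continuous (third_difference g).
Proof.
move=> cg x; have gB (a : R) : (fun y => g (y - a)) @ x --> g (x - a).
  apply: (@continuous_comp _ _ _ (fun y : R => y - a) g); last exact: cg.
  by apply: cvgB; [exact: cvg_id|exact: cvg_cst].
apply: cvgB; last exact: gB.
apply: cvgD; last by apply: cvgMr; exact: gB.
by apply: cvgB; [exact: cg|apply: cvgMr; exact: gB].
Qed.

Let continuous_pos : continuous (fun x : R => Num.max x 0).
Proof. by move=> x; apply: continuous_max; [exact: cvg_id|exact: cvg_cst]. Qed.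

Let continuous_posX n : continuous (fun x : R => Num.max x 0 ^+ n).
Proof.
move=> x; apply: (@continuous_comp _ _ _
  (fun y : R => Num.max y 0) (fun y => y ^+ n)).
  exact: continuous_pos.
exact: exprn_continuous.
Qed.

Lemma continuous_smooth_step : continuous smooth_step.
Proof.
move=> x; apply: cvgMl; exact: continuous_third_difference.
Qed.

Lemma continuous_smooth_step1 : continuous smooth_step1.
Proof.
move=> x; apply: cvgMl; exact: continuous_third_difference.
Qed.

Lemma continuous_smooth_step2 : continuous smooth_step2.
Proof. exact: continuous_third_difference. Qed.

End smooth_step.

Section ramp.
Context {R : realType}.
Variables (b c : R).
Hypothesis b1 : 1 <= b.

(** A decreasing step from 1 to 0 on the interval from [c - 3 / b] to [c];
    [ramp1] and [ramp2] are its derivatives. *)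
Definition ramp y : R := smooth_step (b * (c - y)).
Definition ramp1 y : R := - b * smooth_step1 (b * (c - y)).
Definition ramp2 y : R := b ^+ 2 * smooth_step2 (b * (c - y)).

Let b0 : 0 < b. Proof. exact: lt_le_trans b1. Qed.

Let ramp_rem x h : taylor_rem ramp ramp1 ramp2 x h =
  taylor_rem smooth_step smooth_step1 smooth_step2 (b * (c - x)) (- b * h).
Proof.
rewrite /taylor_rem /ramp /ramp1 /ramp2.
rewrite (_ : b * (c - (x + h)) = b * (c - x) + - b * h); last by ring.
by field.
Qed.

Lemma ramp_taylor2 x h : `|taylor_rem ramp ramp1 ramp2 x h| <= 3 * b ^+ 3 * h ^+ 2.
Proof.
rewrite ramp_rem (le_trans (smooth_step_taylor2 _ _))// exprMn sqrrN mulrA.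
by rewrite ler_wpM2r ?sqr_ge0// ler_wpM2l// ler_weXn2l.
Qed.

Lemma ramp_taylor3 x h :
  `|taylor_rem ramp ramp1 ramp2 x h| <= 3 * b ^+ 3 * `|h| ^+ 3.
Proof.
rewrite ramp_rem (le_trans (smooth_step_taylor3 _ _))//.
by rewrite (_ : `|- b * h| = b * `|h|) ?exprMn ?mulrA// normrM normrN (gtr0_norm b0).
Qed.

Let continuous_arg : continuous (fun y : R => b * (c - y)).
Proof.
by move=> y; apply: cvgMr; apply: cvgB; [exact: cvg_cst|exact: cvg_id].
Qed.

Lemma continuous_ramp : continuous ramp.
Proof.
move=> y; apply: (@continuous_comp _ _ _ (fun y : R => b * (c - y)) smooth_step).
  exact: continuous_arg.
exact: continuous_smooth_step.
Qed.

Lemma measurable_ramp1 : measurable_fun setT ramp1.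
Proof.
apply: measurable_funM => //; apply: measurableT_comp.
  exact: continuous_measurable_fun continuous_smooth_step1.
exact: continuous_measurable_fun continuous_arg.
Qed.

Lemma measurable_ramp2 : measurable_fun setT ramp2.
Proof.
apply: measurable_funM => //; apply: measurableT_comp.
  exact: continuous_measurable_fun continuous_smooth_step2.
exact: continuous_measurable_fun continuous_arg.
Qed.

Lemma ramp_ge0 y : 0 <= ramp y.
Proof. by have [/andP[]] := smooth_step_bounds (b * (c - y)). Qed.

Lemma ramp_le1 y : ramp y <= 1.
Proof. by have [/andP[]] := smooth_step_bounds (b * (c - y)). Qed.

Let b2 : 1 <= b ^+ 2. Proof. exact: exprn_ege1. Qed.

Lemma ramp_bounded y : `|ramp y| <= b ^+ 2.
Proof. by rewrite ger0_norm ?ramp_ge0// (le_trans (ramp_le1 _)). Qed.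

Lemma ramp1_bounded y : `|ramp1 y| <= b ^+ 2.
Proof.
have [_ s1 _] := smooth_step_bounds (b * (c - y)).
rewrite /ramp1 normrM normrN (gtr0_norm b0) expr2.
by rewrite ler_wpM2l ?(ltW b0)// (le_trans s1).
Qed.

Lemma ramp2_bounded y : `|ramp2 y| <= b ^+ 2.
Proof.
have [_ _ s2] := smooth_step_bounds (b * (c - y)).
by rewrite /ramp2 normrM (ger0_norm (sqr_ge0 b)) ler_piMr ?sqr_ge0.
Qed.

Lemma ramp_right y : c <= y -> ramp y = 0.
Proof.
by move=> cy; rewrite /ramp smooth_step_le0// mulr_ge0_le0 ?(ltW b0)// subr_le0.
Qed.

Lemma ramp_left y : y <= c - 3 / b -> ramp y = 1.
Proof.
move=> yc; rewrite /ramp smooth_step_ge3//.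
by rewrite -ler_pdivrMl// mulrC; lra.
Qed.

Lemma Rintegral_ramp {d} {T : measurableType d} (P : probability T R) (Y : T -> R) :
  measurable_fun setT Y ->
  fine (P [set t | Y t <= c - 3 / b]) <= \int[P]_t ramp (Y t) /\
  \int[P]_t ramp (Y t) <= fine (P [set t | Y t <= c]).
Proof.
move=> mY; have mle (a : R) : measurable [set t | Y t <= a].
  have := mY measurableT `]-oo, a]%classic (measurable_itv _); rewrite setTI.
  by congr measurable; apply/seteqP; split => t /=; rewrite in_itv.
have Lind (a : R) : P.-integrable setT (EFin \o \1_[set t | Y t <= a]).
  exact: integrable_indic.
have Lramp : P.-integrable setT (EFin \o (fun t => ramp (Y t))).
  apply: (@L1_bounded _ _ _ _ _ 1) => [|t].
  2: by rewrite ger0_norm ?ramp_ge0 ?ramp_le1.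
  by apply: measurableT_comp => //; exact: continuous_measurable_fun continuous_ramp.
rewrite -!Rintegral_indic//.
split; apply: le_Rintegral => //; move=> t _; rewrite indicE.
  have [/set_mem/= tY|_] := boolP (_ \in _); last exact: ramp_ge0.
  by rewrite ramp_left.
have [_|/negP tY] := boolP (_ \in _); first exact: ramp_le1.
rewrite ramp_right// leNgt; apply/negP => Yc; apply: tY; apply/mem_set => /=.
exact: ltW.
Qed.

End ramp.

(** * The rate of normal approximation of a row *)

Section normal_cdf.
Context {R : realType}.
Local Notation mu := (@lebesgue_measure R).
Local Notation N := (@normal_prob R 0 1).

Definition normal_cdf (x : R) : R := fine (N `]-oo, x]).

Lemma normal_cdf_lipschitz x y : x <= y ->
  normal_cdf y <= normal_cdf x + normal_peak 1 * (y - x).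
Proof.
move=> xy; rewrite -lee_fin EFinD /normal_cdf !fineK ?fin_num_measure//.
rewrite (@itv_bndbnd_setU _ _ _ (BRight x)) ?bnd_simp//.
rewrite measureU//=; last first.
  apply/seteqP; split => // z /= []; rewrite !in_itv/= => zx /andP[].
  by rewrite ltNge zx.
rewrite leeD2l// /normal_prob.
apply: (@le_trans _ _ (\int[mu]_(z in `]x, y]) (cst (normal_peak 1)%:E z))%E).
  apply: ge0_le_integral => //.
  - by move=> z _; rewrite lee_fin normal_pdf_ge0.
  - by apply/measurable_EFinP/measurable_funTS; exact: measurable_normal_pdf.
  - by move=> z _; rewrite lee_fin normal_pdf_ub// oner_neq0.
rewrite integral_cst//= lebesgue_measure_itv/= lte_fin.
case: ltP => //= _; rewrite ?EFinB// mule0 lee_fin.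
by rewrite mulr_ge0 ?normal_peak_ge0// subr_ge0.
Qed.

End normal_cdf.

Section normal_approximation.
Context {R : realType} {d : measure_display} {T : measurableType d}.
Variable P : probability T R.
Context {I : finType} (X : I -> {RV P >-> R}).
Hypothesis indX : mutually_independent X.
Hypothesis sqrX : forall i, P.-integrable setT (EFin \o (fun t => X i t ^+ 2)).
Hypothesis meanX : forall i, \int[P]_t X i t = 0.
Hypothesis var1 : \sum_i \int[P]_t X i t ^+ 2 = 1.
Variables (b e : R).
Hypotheses (b1 : 1 <= b) (e0 : 0 < e) (e1 : e <= 1).
Hypothesis tail_le : \sum_i sqr_tail X e i <= e ^+ 2.

Local Notation N := (@normal_prob R 0 1).
Local Notation L1 f := (P.-integrable setT (EFin \o f)).

Let W := partial_sum X finset.setT.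

Definition approx_const : R := 3 * b ^+ 3 * (2 + 2 * abs_moment3).

Let mW : measurable_fun setT W. Proof. exact: measurable_partial_sum. Qed.

Let swap c :
  `|\int[P]_t ramp b c (W t) - \int[N]_z ramp b c z| <= approx_const * e.
Proof.
have -> : \int[N]_z ramp b c z = gauss_op 1 (ramp b c) 0.
  by apply: eq_Rintegral => z _; rewrite add0r mul1r.
have M0 : 0 <= 3 * b ^+ 3 by rewrite mulr_ge0// exprn_ge0// (le_trans _ b1).
exact: (lindeberg_bound indX sqrX meanX var1 (@continuous_ramp _ b c)
  (ramp_ge0 b c) (ramp_bounded c b1) (measurable_ramp1 b c) (ramp1_bounded c b1)
  (measurable_ramp2 b c) (ramp2_bounded b c) (ramp_taylor2 c b1)
  (ramp_taylor3 c b1) M0 e0 e1 tail_le).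
Qed.

(** The ramp that ends at [x + 3 / b] dominates the indicator of the half-
    line up to [x], the ramp that ends at [x] is dominated by it. Replacing
    [W] by the Gaussian costs [approx_const * e], and the normal
    distribution function varies by at most [normal_peak 1 * (3 / b)] over
    the length of the ramp. *)
Lemma normal_approximation_row (x : R) :
  `|fine (P [set t | W t <= x]) - normal_cdf x| <=
  normal_peak 1 * (3 / b) + approx_const * e.
Proof.
have b0 : 0 < b by exact: lt_le_trans b1.
have db0 : 0 <= 3 / b by rewrite divr_ge0// ltW.
have cdfE c : fine (N [set z | id z <= c]) = normal_cdf c.
  by rewrite /normal_cdf; congr (fine (N _)).
have mid : measurable_fun setT (@id R) by [].
rewrite ler_norml; apply/andP; split.
  have [_ up] := Rintegral_ramp x b1 P mW.
  have [lo _] := Rintegral_ramp x b1 N mid.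
  have := swap x; rewrite ler_norml => /andP[sw _].
  rewrite cdfE in lo.
  have := @normal_cdf_lipschitz _ (x - 3 / b) x.
  rewrite gerBl// opprB addrCA subrr addr0 => /(_ db0); lra.
have [lo _] := Rintegral_ramp (x + 3 / b) b1 P mW.
have [_ up] := Rintegral_ramp (x + 3 / b) b1 N mid.
have := swap (x + 3 / b); rewrite ler_norml => /andP[_ sw].
rewrite cdfE in up; rewrite addrK in lo.
have := @normal_cdf_lipschitz _ x (x + 3 / b).
rewrite lerDl// addrAC subrr add0r => /(_ db0); lra.
Qed.

End normal_approximation.

(** * Standardization and the limit theorem *)

Section standardization.
Context {R : realType} {d : measure_display} {T : measurableType d}.
Variable P : probability T R.

Section scaled.
Variables (a : R) (X : {RV P >-> R}).

Let measurable_scaled : measurable_fun setT (fun t => X t / a).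
Proof. exact: measurable_funM. Qed.

Definition scaled : {RV P >-> R} :=
  HB.pack (fun t => X t / a) (isMeasurableFun.Build _ _ _ _ _ measurable_scaled).

End scaled.

Context {I : finType} (X : I -> {RV P >-> R}).
Hypothesis indX : mutually_independent X.
Hypothesis meanX : forall i, ('E_P[X i] = 0)%E.
Hypothesis sqrX : forall i, ('E_P[fun t => (X i t ^+ 2)%R] < +oo)%E.

Local Notation L1 f := (P.-integrable setT (EFin \o f)).

Let S (t : T) : R := \sum_i X i t.
Let D : R := fine ('V_P[S])%E.
Hypothesis D_gt0 : 0 < D.

Let Y i := scaled (Num.sqrt D) (X i).

Lemma mutually_independent_scaled a : mutually_independent (fun i => scaled a (X i)).
Proof.
move=> J B mB; have := indX (J := J) (B := fun i => (fun x => x / a) @^-1` B i).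
apply => i iJ; rewrite -[_ @^-1` _]setTI.
by apply: measurable_funM => //; exact: mB.
Qed.

Lemma L1_sqr_RV i : L1 (fun t => X i t ^+ 2).
Proof.
apply/integrableP; split; first by apply/measurable_EFinP; exact: measurable_funX.
have := sqrX i; rewrite unlock; apply: le_lt_trans.
rewrite le_eqVlt; apply/orP; left; apply/eqP/eq_integral => t _ /=.
by rewrite ger0_norm// sqr_ge0.
Qed.

Lemma Rintegral_RV i : \int[P]_t X i t = 0.
Proof. by rewrite /Rintegral -expectation_def meanX. Qed.

Let SE : S = partial_sum X finset.setT.
Proof.
by apply/funext => t; rewrite /S /partial_sum; apply: eq_bigl => i; rewrite inE.
Qed.

(** The sum has mean zero, so its variance is its second moment, to which
    the independent entries contribute separately. *)
Lemma row_variance : D = \sum_i \int[P]_t X i t ^+ 2.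
Proof.
have [L2 E2] := partial_sum_sqr indX L1_sqr_RV Rintegral_RV finset.setT.
have ES : ('E_P[S] = 0)%E.
  have LS : L1 S by rewrite SE; exact: L1_partial_sum L1_sqr_RV _.
  have h : \int[P]_t S t = 0.
    by rewrite SE; exact: mean_partial_sum L1_sqr_RV Rintegral_RV _.
  rewrite unlock -[LHS]fineK; last exact: integrable_fin_num LS.
  by congr _%:E; exact: h.
rewrite /D /variance unlock ES /= unlock.
rewrite [RHS](_ : _ = \int[P]_t partial_sum X finset.setT t ^+ 2); last first.
  by rewrite E2; apply: eq_bigl => i; rewrite inE.
congr fine; apply: eq_integral => t _ /=; rewrite SE.
by rewrite fctE /= subr0 expr2.
Qed.

Lemma mutually_independent_standard : mutually_independent Y.
Proof. exact: mutually_independent_scaled. Qed.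

Let sqrtD_gt0 : 0 < Num.sqrt D. Proof. by rewrite sqrtr_gt0. Qed.

Let Y_sqrE i t : Y i t ^+ 2 = D^-1 * X i t ^+ 2.
Proof. by rewrite /Y /= expr_div_n sqr_sqrtr ?ltW// mulrC. Qed.

Lemma L1_sqr_standard i : L1 (fun t => Y i t ^+ 2).
Proof.
have := L1Z D^-1 (L1_sqr_RV i).
by apply: eq_integrable => // t _ /=; rewrite -Y_sqrE.
Qed.

Lemma mean_standard i : \int[P]_t Y i t = 0.
Proof.
rewrite /Y /= RintegralZr// ?Rintegral_RV ?mul0r//.
by apply: L1_of_sqr => //; exact: L1_sqr_RV.
Qed.

Lemma variance_standard : \sum_i \int[P]_t Y i t ^+ 2 = 1.
Proof.
transitivity (D^-1 * \sum_i \int[P]_t X i t ^+ 2).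
  rewrite mulr_sumr; apply: eq_bigr => i _.
  rewrite -RintegralZl//; last exact: L1_sqr_RV.
  by apply: eq_Rintegral => t _; rewrite Y_sqrE.
by rewrite -row_variance mulVf// gt_eqF.
Qed.

Lemma sum_standard t : partial_sum Y finset.setT t = S t / Num.sqrt D.
Proof.
by rewrite /S mulr_suml /partial_sum; apply: eq_bigl => i; rewrite inE.
Qed.

Lemma le_prob_exceeding e : 0 < e ->
  (P (exceeding Y e) <=
   P [set t | (e <= \big[Num.max/0]_i (`|X i t| / Num.sqrt D))%R])%E.
Proof.
move=> e0; apply: le_measure.
- by apply/mem_set; exact: measurable_exceeding.
- apply/mem_set.
  rewrite (_ : [set _ | _] = \bigcup_(i in [set: I]) [set t | e <= `|Y i t|]).
    apply: fin_bigcup_measurable => // i _.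
    have mY : measurable_fun setT (fun t => `|Y i t|).
      by apply: measurableT_comp => //; exact: normr_measurable.
    have := mY measurableT `[e, +oo[%classic (measurable_itv _); rewrite setTI.
    by congr measurable; apply/seteqP; split => t /=; rewrite in_itv/= andbT.
  apply/seteqP; split => t /=.
    move=> /bigmax_geP[|[i _ ei]]; first by rewrite leNgt e0.
    by exists i => //=; rewrite normrM normfV (gtr0_norm sqrtD_gt0).
  move=> [i _ /=]; rewrite normrM normfV (gtr0_norm sqrtD_gt0) => ei.
  by apply/bigmax_geP; right; exists i.
- move=> t [i /= ei]; apply/bigmax_geP; right; exists i => //.
  by rewrite ltW//; move: ei; rewrite normrM normfV (gtr0_norm sqrtD_gt0).
Qed.

(** On [exceeding Y e], the square of the standardized sum is at most [C]
    unless it belongs to the tail above [C], whose integral is at most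
    [delta]. *)
Lemma square_tails_le (e C delta : R) : 0 < e -> e <= 1 -> 0 <= C ->
  (\int[P]_(t in [set t | (C < `|S t ^+ 2 / D|)%R]) (`|S t ^+ 2 / D|%R)%:E
     <= delta%:E)%E ->
  fine (P (exceeding Y e)) <= e ^+ 2 / 32 ->
  \sum_i sqr_tail Y e i <= 2 * (delta + C * fine (P (exceeding Y e))).
Proof.
move=> e0 e1 C0 ui rare.
have [L2 E2] := partial_sum_sqr mutually_independent_standard L1_sqr_standard
  mean_standard finset.setT.
have W2 : \int[P]_t partial_sum Y finset.setT t ^+ 2 = 1.
  by rewrite E2 -variance_standard; apply: eq_bigl => i; rewrite inE.
have := lindeberg_of_rare_excess mutually_independent_standard L1_sqr_standard
  mean_standard e0 e1 W2 rare.
move=> /le_trans; apply; rewrite ler_wpM2l//.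
set W := partial_sum Y finset.setT in L2 W2 *.
have WE t : S t ^+ 2 / D = W t ^+ 2.
  by rewrite /W sum_standard expr_div_n sqr_sqrtr// ltW.
have mW : measurable_fun setT W by exact: measurable_partial_sum L1_sqr_standard _.
set A := [set t | (C < `|S t ^+ 2 / D|)%R] in ui *.
have mA : measurable A.
  have mW2 : measurable_fun setT (fun t => W t ^+ 2) by exact: measurable_funX.
  have := mW2 measurableT `]C, +oo[%classic (measurable_itv _); rewrite setTI.
  congr measurable; apply/seteqP.
  by split => t; rewrite /A /= in_itv/= andbT WE ger0_norm// sqr_ge0.
have mE := measurable_exceeding Y e.
have m1 (B : set T) : measurable B -> measurable_fun setT (\1_B : T -> R).
  by move=> mB; exact: measurable_indic.
have bnd1 (B : set T) t : `|\1_B t : R| <= 1.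
  by rewrite indicE; case: (_ \in _); rewrite ?normr1 ?normr0 ?ler01.
have LA : L1 (fun t => W t ^+ 2 * \1_A t).
  exact: (L1_mulbnd (m1 _ mA) (bnd1 A) L2).
have LWE : L1 (fun t => W t ^+ 2 * \1_(exceeding Y e) t).
  exact: (L1_mulbnd (m1 _ mE) (bnd1 _) L2).
have L1E : L1 (\1_(exceeding Y e)).
  by apply: (@L1_bounded _ _ _ _ _ 1) => [|t]; [exact: m1|exact: bnd1].
have EA : \int[P]_t (W t ^+ 2 * \1_A t) <= delta.
  rewrite -lee_fin fineK; last exact: integrable_fin_num LA.
  apply: le_trans ui; rewrite [leRHS]integral_mkcond le_eqVlt; apply/orP; left.
  apply/eqP/eq_integral => t _; rewrite patchE indicE.
  by case: ifPn => _; rewrite ?mulr0// mulr1 WE ger0_norm// sqr_ge0.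
apply: (@le_trans _ _ (\int[P]_t (W t ^+ 2 * \1_A t + C * \1_(exceeding Y e) t))).
  apply: le_Rintegral => //; first by apply: L1D => //; exact: L1Z.
  move=> t _; rewrite [\1_A t]indicE [\1_(exceeding _ _) t]indicE.
  have [_|/negP tA] := boolP (t \in A).
    case: (_ \in _); rewrite ?mulr1 ?mulr0 ?addr0 ?lerDl// sqr_ge0//.
  rewrite mulr0 add0r; case: (_ \in _); rewrite ?mulr0// !mulr1.
  rewrite leNgt; apply/negP => Ct; apply: tA; apply/mem_set.
  by rewrite /A /= WE ger0_norm// sqr_ge0.
rewrite RintegralD//; last exact: L1Z.
by rewrite RintegralZl// Rintegral_indic// lerD2r.
Qed.

End standardization.

Lemma normal_cdfE (R : realType) (x : R) :
  (((Num.sqrt (2 * pi))^-1)%:E *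
    \int[lebesgue_measure]_(t in `]-oo, x]) (expR (- t ^+ 2 / 2))%:E
  = (normal_cdf x)%:E)%E.
Proof.
rewrite /normal_cdf fineK ?fin_num_measure// /normal_prob.
rewrite -ge0_integralZl//.
- apply: eq_integral => t _; rewrite -EFinM normal_pdf01E /normal_peak expr1n mul1r.
  by rewrite -[pi *+ 2]mulr_natl.
- apply/measurable_EFinP/measurable_funTS; apply: measurableT_comp => //.
  by apply: measurable_funM => //; apply: measurableT_comp.
Qed.

Unset Implicit Arguments.
Local Open Scope ereal_scope.

Theorem theorem3 (R : realType) (d : measure_display) (T : measurableType d)
    (P : probability T R) (k : nat -> nat)
    (xi : forall n : nat, 'I_(k n) -> {RV P >-> R})
    (k_gt0 : forall n, (1 <= n)%N -> (0 < k n)%N)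
    (k_cvg : k n @[n --> \oo] --> \oo)
    (xi_indep : forall n, (1 <= n)%N -> mutually_independent (xi n))
    (xi_mean : forall n, (1 <= n)%N -> forall j, 'E_P[xi n j] = 0)
    (xi_sqr : forall n, (1 <= n)%N -> forall j,
      'E_P[fun t => (xi n j t ^+ 2)%R] < +oo)
    (var_gt0 : forall n, (1 <= n)%N -> (0 < row_var xi n)%R)
    (max_small : forall eps : R, (0 < eps)%R ->
      P [set t | (eps <=
        \big[Num.max/0]_(j < k n) (`|xi n j t| / Num.sqrt (row_var xi n)))%R]
        @[n --> \oo] --> 0)
    (sqr_ui : uniformly_integrable P [set n | (1 <= n)%N]
      (fun n t => (row_sum xi n t ^+ 2 / row_var xi n)%R)) :
  forall x : R,
    P [set t | (row_sum xi n t / Num.sqrt (row_var xi n) <= x)%R]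
      @[n --> \oo] -->
    ((Num.sqrt (2 * pi))^-1)%:E *
      \int[lebesgue_measure]_(t in `]-oo, x]) (expR (- t ^+ 2 / 2))%:E.
Proof.
move=> x; rewrite normal_cdfE.
have mrow n : measurable
    [set t | (row_sum xi n t / Num.sqrt (row_var xi n) <= x)%R].
  have mS : measurable_fun setT
      (fun t => row_sum xi n t / Num.sqrt (row_var xi n))%R.
    by apply: measurable_funM => //; exact: measurable_sum.
  have := mS measurableT `]-oo, x]%classic (measurable_itv _); rewrite setTI.
  by congr measurable; apply/seteqP; split => t /=; rewrite in_itv.
apply/fine_cvgP; split; first by apply: nearW => n; exact: fin_num_measure.
apply/cvgrPdist_le => eps eps0.
(* the steepness [b] and then the level [e] make each of the two errors of
   [normal_approximation_row] at most [eps / 2] *)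
pose peak : R := normal_peak 1; pose b : R := (1 + 6 * peak / eps)%R.
have peak0 : (0 <= peak)%R by exact: normal_peak_ge0.
have b1 : (1 <= b)%R by rewrite lerDl divr_ge0 ?mulr_ge0// ltW.
have b0 : (0 < b)%R by exact: lt_le_trans b1.
pose C : R := approx_const b.
have kappa0 : (0 <= @abs_moment3 R)%R.
  by apply: Rintegral_ge0 => z _; exact: exprn_ge0.
have C0 : (0 <= C)%R.
  rewrite /C /approx_const mulr_ge0 ?mulr_ge0 ?exprn_ge0 ?(ltW b0)//.
  by rewrite addr_ge0 ?mulr_ge0.
pose e : R := (eps / (2 * (C + 1) + eps))%R.
have den0 : (0 < 2 * (C + 1) + eps)%R by lra.
have e0 : (0 < e)%R by exact: divr_gt0.
have e1 : (e <= 1)%R by rewrite ler_pdivrMr// mul1r; lra.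
have peak_le : (peak * (3 / b) <= eps / 2)%R.
  rewrite mulrA ler_pdivrMr//.
  have -> : (eps / 2 * b = eps / 2 + 3 * peak)%R.
    by rewrite /b; field; rewrite gt_eqF.
  lra.
have C_le : (C * e <= eps / 2)%R.
  rewrite /e mulrA ler_pdivrMr//; nra.
have e2 : (0 < e ^+ 2)%R by exact: exprn_gt0.
(* a truncation level for the squares, uniform in the row *)
have [c [c0 ui]] : exists c : R, (0 < c)%R /\ forall n, (1 <= n)%N ->
    \int[P]_(t in [set t | (c < `|row_sum xi n t ^+ 2 / row_var xi n|)%R])
      (`|row_sum xi n t ^+ 2 / row_var xi n|%R)%:E <= (e ^+ 2 / 4)%:E.
  have near_ui : \forall c \near +oo%R, ereal_sup
      [set \int[P]_(t in [set t | (c < `|row_sum xi n t ^+ 2 / row_var xi n|)%R])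
      (`|row_sum xi n t ^+ 2 / row_var xi n|%R)%:E | n in [set n | (1 <= n)%N]]
      < (e ^+ 2 / 4)%:E.
    apply: (sqr_ui [set y | y < (e ^+ 2 / 4)%:E]).
    apply: open_nbhs_nbhs; split; first exact: open_ereal_lt_ereal.
    by rewrite /= lte_fin divr_gt0.
  have [c [cu c0]] :=
    filter_ex (filterI near_ui (nbhs_pinfty_gt (num_real (0 : R)))).
  exists c; split=> // n n1; apply: le_trans (ltW cu).
  by apply: ereal_sup_ubound; exists n.
(* below [e ^+ 2 / 32], exceedances are rare; below [e ^+ 2 / (4 * c)], the part
   of the square under the level [c] contributes at most [e ^+ 2 / 4] *)
pose r : R := Num.min (e ^+ 2 / 32)%R (e ^+ 2 / (4 * c))%R.
have r0 : (0 < r)%R by rewrite lt_min !divr_gt0// mulr_gt0.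
have near_max : \forall n \near \oo, P [set t | (e <=
    \big[Num.max/0]_(j < k n) (`|xi n j t| / Num.sqrt (row_var xi n)))%R] < r%:E.
  apply: (max_small e e0 [set y | y < r%:E]).
  apply: open_nbhs_nbhs; split; first exact: open_ereal_lt_ereal.
  by rewrite /= lte_fin.
near=> n.
have n1 : (1 <= n)%N by near: n; exact: nbhs_infty_ge.
pose X (j : 'I_(k n)) := scaled (Num.sqrt (row_var xi n)) (xi n j).
have PE_le : (fine (P (exceeding X e)) <= r)%R.
  rewrite -lee_fin fineK; last first.
    by apply: fin_num_measure; exact: measurable_exceeding.
  apply: le_trans (le_prob_exceeding (var_gt0 n n1) e0) _.
  by apply: ltW; near: n; exact: near_max.
have rare : (fine (P (exceeding X e)) <= e ^+ 2 / 32)%R.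
  by rewrite (le_trans PE_le)// ge_min lexx.
have tails := square_tails_le (xi_indep n n1) (xi_mean n n1) (xi_sqr n n1)
  (var_gt0 n n1) e0 e1 (ltW c0) (ui n n1) rare.
have tail_le : (\sum_i sqr_tail X e i <= e ^+ 2)%R.
  apply: le_trans tails _.
  have : (c * fine (P (exceeding X e)) <= e ^+ 2 / 4)%R.
    rewrite mulrC -ler_pdivlMr// (le_trans PE_le)// ge_min.
    by rewrite invfM mulrA lexx orbT.
  set q := (c * fine _)%R; lra.
have := normal_approximation_row (mutually_independent_standard (xi_indep n n1))
  (L1_sqr_standard (xi_sqr n n1) (var_gt0 n n1))
  (mean_standard (xi_mean n n1) (xi_sqr n n1))
  (variance_standard (xi_indep n n1) (xi_mean n n1) (xi_sqr n n1) (var_gt0 n n1))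
  b1 e0 e1 tail_le x.
rewrite distrC /= (_ : [set t | (partial_sum _ _ t <= x)%R] =
    [set t | (row_sum xi n t / Num.sqrt (row_var xi n) <= x)%R]); last first.
  by apply/seteqP; split => t /=; rewrite sum_standard.
move=> /le_trans; apply; move: peak_le C_le; rewrite /peak /C; lra.
Unshelve. all: by end_near. Qed.
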